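(* Let $(V,E)$ be a connected finite graph with symmetric positive weights, let $\lambda\in\mathbb{R}$ and $f:V\to\mathbb{R}$, let $X=L^\infty(V)$, and let $F:X\to X$ be the map $$F(u)=-\Delta u+\lambda e^{u}(e^u-1)+f.$$ Suppose that $\lambda\int_V f\,d\mu\neq 0$. Then there exists a large number $R_0>0$ such that for all $R\geq R_0$, $$\deg(F,B_R,0)=\begin{cases}1 & \text{if } \lambda>0,\ \int_V f\,d\mu<0,\\ 0 & \text{if } \lambda\int_V f\,d\mu>0,\\ -1 & \text{if } \lambda<0,\ \int_V f\,d\mu>0,\end{cases}$$ where $B_R=\{u\in X:\|u\|_{L^\infty(V)}<R\}$.
   Context: $(V,E)$ is a connected finite graph with vertex set $V$ and edge set $E$, equipped with a measure $\mu:V\to(0,+\infty)$ and weights $\{w_{xy}:xy\in E\}$ which are positive and symmetric ($w_{xy}=w_{yx}$). Write $y\sim x$ if $xy\in E$. For $u:V\to\mathbb{R}$, $\Delta u(x)=\frac{1}{\mu(x)}\sum_{y\sim x}w_{xy}(u(y)-u(x))$, $\int_V u\,d\mu=\sum_{x\in V}\mu(x)u(x)$, $\|u\|_{L^\infty(V)}=\max_{x\in V}|u(x)|$. $X=L^\infty(V)$ is the space of all functions $V\to\mathbb{R}$, identified with $\mathbb{R}^\ell$, where $\ell$ is the number of vertices; $\deg$ is the Brouwer (topological) degree. *)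

(* Defs.v *)
(* MathComp / MathComp-Analysis. *)
From HB Require Import structures.
From mathcomp Require Import all_boot all_order all_algebra.
From mathcomp Require Import all_classical all_reals all_analysis.

Set Implicit Arguments.
Unset Strict Implicit.
Unset Printing Implicit Defensive.

Import Order.TTheory GRing.Theory Num.Theory.
Import numFieldNormedType.Exports.

Local Open Scope classical_set_scope.
Local Open Scope ring_scope.

Definition C1_map (R : realType) (m n : nat) (G : 'rV[R]_m -> 'rV[R]_n) : Prop :=
  (forall x, differentiable G x) /\ (forall v, continuous ('D_v G)).

Definition C2_map (R : realType) (m n : nat) (G : 'rV[R]_m -> 'rV[R]_n) : Prop :=
  (forall x, differentiable G x) /\ (forall v, C1_map ('D_v G)).

(* For open D, this is the topological boundary. *)
Definition bdry (R : realType) (n : nat) (D : set 'rV[R]_n) : set 'rV[R]_n :=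
  closure D `\` D.

Definition degree_admissible (R : realType) (n : nat)
    (F : 'rV[R]_n -> 'rV[R]_n) (D : set 'rV[R]_n) (p : 'rV[R]_n) : Prop :=
  [/\ open D, bounded_set D, {within closure D, continuous F}
    & forall x, bdry D x -> F x <> p].

Definition regular_value_on (R : realType) (n : nat)
    (G : 'rV[R]_n -> 'rV[R]_n) (D : set 'rV[R]_n) (p : 'rV[R]_n) : Prop :=
  forall x, D x -> G x = p -> \det ('J G x) != 0.

(* The Jacobian 'J acts on row vectors, so it is the transpose of the usual
   one; its determinant is the same.  The sum ranges over a finite set whenever
   D is bounded, G is C^1, p is not attained on the boundary of D and p is a
   regular value. *)
Definition regular_degree (R : realType) (n : nat)
    (G : 'rV[R]_n -> 'rV[R]_n) (D : set 'rV[R]_n) (p : 'rV[R]_n) : int :=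
  \sum_(x \in D `&` G @^-1` [set p]) sgz (\det ('J G x)).

(* sup_(closure D) |G - F| < dist (p, F (bdry D)), with a separating number r *)
Definition regular_approx (R : realType) (n : nat)
    (F : 'rV[R]_n -> 'rV[R]_n) (D : set 'rV[R]_n) (p : 'rV[R]_n)
    (G : 'rV[R]_n -> 'rV[R]_n) : Prop :=
  [/\ C2_map G, regular_value_on G D p
    & exists2 r : R, (forall x, bdry D x -> r <= `|F x - p|)
                   & (forall x, closure D x -> `|G x - F x| < r)].

(* The Brouwer degree deg (F, D, p), obtained from the signed count of
   preimages of a C^2 approximation of F having p as a regular value.  For an
   admissible triple such approximations exist (Weierstrass, Sard) and, by
   homotopy invariance, all give the same integer.  The default value 0 is only
   reached for inadmissible triples. *)
Definition brouwer_degree (R : realType) (n : nat)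
    (F : 'rV[R]_n -> 'rV[R]_n) (D : set 'rV[R]_n) (p : 'rV[R]_n) : int :=
  xget 0 [set d : int | exists2 G, regular_approx F D p G
                                 & d = regular_degree G D p].

(* The space of functions V -> R, identified with R^#|V| through the
   enumeration of V. *)
Definition coords (R : realType) (V : finType) (u : V -> R) : 'rV[R]_#|V| :=
  \row_i u (enum_val i).

Definition of_coords (R : realType) (V : finType) (x : 'rV[R]_#|V|) : V -> R :=
  fun v => x ord0 (enum_rank v).

Definition in_coords (R : realType) (V : finType)
    (F : (V -> R) -> (V -> R)) : 'rV[R]_#|V| -> 'rV[R]_#|V| :=
  fun x => coords (F (of_coords x)).

Definition fun_degree_admissible (R : realType) (V : finType)
    (F : (V -> R) -> (V -> R)) (D : set (V -> R)) (p : V -> R) : Prop :=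
  degree_admissible (in_coords F) (@coords R V @` D) (coords p).

Definition fun_degree (R : realType) (V : finType)
    (F : (V -> R) -> (V -> R)) (D : set (V -> R)) (p : V -> R) : int :=
  brouwer_degree (in_coords F) (@coords R V @` D) (coords p).

Definition laplacian (R : realType) (V : finType) (E : rel V)
    (mu : V -> R) (w : V -> V -> R) (u : V -> R) : V -> R :=
  fun x => (mu x)^-1 * \sum_(y | E x y) w x y * (u y - u x).

Definition integralV (R : realType) (V : finType) (mu u : V -> R) : R :=
  \sum_x mu x * u x.

Definition linf_norm (R : realType) (V : finType) (u : V -> R) : R :=
  \big[Num.max/0]_x `|u x|.

Definition linf_ball (R : realType) (V : finType) (r : R) : set (V -> R) :=
  [set u | linf_norm u < r].

Definition CSH_map (R : realType) (V : finType) (E : rel V)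
    (mu : V -> R) (w : V -> V -> R) (lambda : R) (f : V -> R)
    (u : V -> R) : V -> R :=
  fun x => - laplacian E mu w u x
           + lambda * expR (u x) * (expR (u x) - 1) + f x.

(* Main.v *)
(* Let chi_k be 1 where the k-th component of a map G is positive and 0
   elsewhere.  On a fine grid of a cube the cochain d(chi_0) cup d(chi_1) cup ...
   lives on cells in which every component of G changes sign, hence near the
   zeros of G.  By Stokes its sum over the cube depends only on boundary values:
   it is unchanged by homotopies without zeros on the boundary.  Homotoping to
   the linearisation, and that one to a diagonal matrix, shows that a regular
   zero contributes the sign of the Jacobian determinant, so that the sum is the
   signed count of preimages for every regular approximation; such
   approximations exist by an elementary counting version of Sard's lemma.

   A maximum principle, an oscillation bound for the Laplacian and the integral
   of the equation bound all zeros, uniformly along the following homotopies.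
   If lambda > 0 > int f, replace f by its mean and then drop the Laplacian: the
   map decouples into increasing functions.  If lambda int f > 0, add a multiple
   of lambda to f until no zero is left.  If lambda < 0 < int f, replace the
   reaction term by its mean; what remains is homotopic to the reflection in one
   coordinate. *)
Require Import Defs.
From HB Require Import structures.
From mathcomp Require Import all_boot all_order all_algebra all_fingroup.
From mathcomp Require Import all_classical all_reals all_analysis.
From mathcomp Require Import zify ring lra.

Set Implicit Arguments.
Unset Strict Implicit.
Unset Printing Implicit Defensive.

Import Order.TTheory GRing.Theory Num.Theory.
Import numFieldNormedType.Exports.

Local Open Scope classical_set_scope.
Local Open Scope ring_scope.

(** * Cubical cochains on a grid *)

(** [brouwer_degree] selects an arbitrary signed count, so its value is known only once all regular
    approximations are shown to agree. The grid sum is an integer attached to any continuous map,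
    and each count is compared with it. Signs are discontinuous, so the argument needs a mesh that
    is fine relative to the minimum of the norm over the boundary and the homotopy time; hence every
    equality of grid degrees is stated for all sufficiently fine meshes. In the sup norm a ball is a
    cube, and the boundary vertices of its grid lie exactly on the sphere. The case lambda < 0 < int
    f needs its own route. Dropping the Laplacian would leave components that are positive at -r and
    negative at r, that is, the sign (-1)^l for l vertices; the maximum principle bounds zeros along
    such a homotopy only for lambda > 0. Passing to the mean keeps the Laplacian in place, and only
    the direction of the constants contributes a sign. *)

Section Cochains.
Variable n : nat.
Implicit Types (i j k : 'I_n) (I J : {set 'I_n}) (s : seq 'I_n).

Definition gridpt := 'I_n -> nat.
(* The value at [x] and [I] is the value on the cube with lowest vertex [x] and
   edge directions [I]. *)
Definition cochain := gridpt -> {set 'I_n} -> int.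
Implicit Types (x y : gridpt) (c : gridpt -> int) (om : cochain).

Definition gstep x i : gridpt := fun j => (x j + (j == i))%N.

Lemma gstepC x i j : gstep (gstep x i) j = gstep (gstep x j) i.
Proof. by apply/funext => k; rewrite /gstep addnAC. Qed.

Definition possign i I : int := (-1) ^+ #|[set j in I | (j < i)%N]|.

(** For i < j, deleting j leaves the number of elements below i unchanged, while deleting i lowers
    the number below j by one; this single unit is the sign. *)
Lemma possign_swap i j I : i \in I -> j \in I -> i != j ->
  possign i I * possign j (I :\ i) = - (possign j I * possign i (I :\ j)).
Proof.
wlog ltij : i j / (i < j)%N.
  move=> H iI jI neq; case: (ltnP i j) => [|le]; first by move=> lt; apply: H.
  rewrite [in RHS]H ?opprK // 1?eq_sym //.
  by rewrite ltn_neqAle le andbT eq_sym; move: neq; apply: contraNneq => /val_inj ->.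
move=> iI jI neq; rewrite /possign.
have -> : [set k in I :\ j | (k < i)%N] = [set k in I | (k < i)%N].
  apply/setP => k; rewrite !inE; case: eqP => [->|] //=.
  by rewrite jI /= ltnNge ltnW.
have -> : [set k in I :\ i | (k < j)%N] = [set k in I | (k < j)%N] :\ i.
  by apply/setP => k; rewrite !inE andbA.
rewrite (cardsD1 i [set k in I | (k < j)%N]) inE iI ltij /= exprS.
ring.
Qed.

Definition cobound om : cochain := fun x I =>
  \sum_(i in I) possign i I * (om (gstep x i) (I :\ i) - om x (I :\ i)).

(** Cubical cup product of the coboundary of [c] with [om]: an edge in direction i, then the
    complementary face starting where that edge ends, with the sign of the shuffle. Starting the
    face there makes the Leibniz rule [cupE] exact. *)
Definition cup c om : cochain := fun x I =>
  \sum_(i in I) possign i I * ((c (gstep x i) - c x) * om (gstep x i) (I :\ i)).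

Definition cscale c om : cochain := fun x I => c x * om x I.

Lemma antisym_sum_eq0 I (F : 'I_n -> 'I_n -> int) :
  (forall i j, i \in I -> j \in I -> i != j -> F i j = - F j i) ->
  \sum_(i in I) \sum_(j in I :\ i) F i j = 0.
Proof.
move=> FN; set S := \sum_(i in I) _.
suff : S = - S by move/eqP; rewrite -subr_eq0 opprK -mulr2n mulrn_eq0 => /eqP.
rewrite {1}/S (exchange_big_dep (mem I)) /=; last first.
  by move=> i j iI; rewrite !inE => /andP[].
rewrite -sumrN; apply: eq_bigr => j jI; rewrite -sumrN.
apply: congr_big => // [i | i].
  by rewrite !inE jI andbT eq_sym andbC.
by rewrite !inE jI andbT eq_sym => /andP[iI ne]; apply: FN => //; rewrite eq_sym.
Qed.

Lemma coboundK om x I : cobound (cobound om) x I = 0.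
Proof.
have -> : cobound (cobound om) x I = \sum_(i in I) \sum_(j in I :\ i)
  possign i I * possign j (I :\ i) *
  (om (gstep (gstep x i) j) (I :\ i :\ j) - om (gstep x i) (I :\ i :\ j)
   - (om (gstep x j) (I :\ i :\ j) - om x (I :\ i :\ j))).
  rewrite /cobound; apply: eq_bigr => i iI; rewrite -sumrB mulr_sumr.
  by apply: eq_bigr => j jI; ring.
apply: antisym_sum_eq0 => i j iI jI ne.
rewrite possign_swap // gstepC.
have -> : I :\ i :\ j = I :\ j :\ i by apply/setP => k; rewrite !inE andbCA.
ring.
Qed.

Lemma cupE c om x I :
  cup c om x I = cobound (cscale c om) x I - c x * cobound om x I.
Proof.
rewrite /cup /cobound mulr_sumr -sumrB; apply: eq_bigr => i _.
by rewrite /cscale; ring.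
Qed.

Lemma cup_cobound c om x I :
  cup c (cobound om) x I = - cobound (cup c om) x I.
Proof.
have -> : cup c om = fun x I => cobound (cscale c om) x I - cscale c (cobound om) x I.
  by apply/funext => y; apply/funext => J; exact: cupE.
have coboundB o1 o2 : cobound (fun x I => o1 x I - o2 x I) x I =
    cobound o1 x I - cobound o2 x I.
  by rewrite /cobound -sumrB; apply: eq_bigr => i _; ring.
by rewrite coboundB coboundK sub0r opprK cupE coboundK mulr0 subr0.
Qed.

Definition cochain1 : cochain := fun _ I => (I == finset.set0)%:R.

Definition cupseq (chi : 'I_n -> gridpt -> int) s om : cochain :=
  foldr (fun k o => cup (chi k) o) om s.

Lemma cobound_cupseq1 chi s x I : cobound (cupseq chi s cochain1) x I = 0.
Proof.
elim: s x I => [|k s IH] x I /=.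
  by rewrite /cobound big1 // => i _; rewrite subrr mulr0.
have -> : cup (chi k) (cupseq chi s cochain1) =
          cobound (cscale (chi k) (cupseq chi s cochain1)).
  by apply/funext => y; apply/funext => J; rewrite cupE IH mulr0 subr0.
exact: coboundK.
Qed.

Lemma cupseq_cobound chi s om x I :
  cupseq chi s (cobound om) x I = (-1) ^+ size s * cobound (cupseq chi s om) x I.
Proof.
elim: s x I => [|k s IH] x I /=; first by rewrite mul1r.
have -> : cupseq chi s (cobound om) =
          fun x I => (-1) ^+ size s * cobound (cupseq chi s om) x I.
  by apply/funext => y; apply/funext => J; exact: IH.
rewrite exprS mulN1r mulNr -mulrN -cup_cobound /cup mulr_sumr.
by apply: eq_bigr => i _; ring.
Qed.

Lemma eq_cupseq chi chi' s om :
  (forall k, k \in s -> chi k = chi' k) -> cupseq chi s om = cupseq chi' s om.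
Proof.
elim: s => //= k s IH H; rewrite H ?mem_head// IH// => l ls.
by rewrite H // inE ls orbT.
Qed.

Lemma cupseqB chi s o1 o2 x I :
  cupseq chi s (fun x I => o1 x I - o2 x I) x I =
  cupseq chi s o1 x I - cupseq chi s o2 x I.
Proof.
elim: s x I => //= k s IH x I.
rewrite /cup -sumrB; apply: eq_bigr => i _; rewrite IH; ring.
Qed.

(** All factors are closed, so exchanging one of them alters the product by a coboundary: the
    difference is d of [chi' j - chi j] times the closed tail, and each factor in front lets d pass
    at the cost of one sign. *)
Lemma cupseq_change chi chi' j s1 s2 x I : j \notin s1 -> j \notin s2 ->
  (forall k, k != j -> chi k = chi' k) ->
  cupseq chi' (s1 ++ j :: s2) cochain1 x I -
  cupseq chi (s1 ++ j :: s2) cochain1 x I =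
  (-1) ^+ size s1 * cobound (cupseq chi s1
    (cscale (fun y => chi' j y - chi j y) (cupseq chi s2 cochain1))) x I.
Proof.
move=> j1 j2 H; rewrite /cupseq !foldr_cat /=.
rewrite -!/(cupseq _ _ _) -cupseq_cobound.
rewrite (@eq_cupseq chi' chi s1); last first.
  by move=> k ks; rewrite H //; apply: contraNneq j1 => <-.
rewrite (@eq_cupseq chi' chi s2); last first.
  by move=> k ks; rewrite H //; apply: contraNneq j2 => <-.
rewrite -cupseqB; congr cupseq; apply/funext => y; apply/funext => J.
rewrite !cupE cobound_cupseq1 !mulr0 !subr0 /cobound -sumrB.
by apply: eq_bigr => i _; rewrite /cscale; ring.
Qed.

Definition in_cell x I y := forall j, (x j <= y j <= x j + (j \in I))%N.

Lemma in_cell_refl x I : in_cell x I x.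
Proof. by move=> j; rewrite leqnn leq_addr. Qed.

Lemma in_cell_step x I i y : i \in I -> in_cell (gstep x i) (I :\ i) y -> in_cell x I y.
Proof.
move=> iI H j; move: (H j); rewrite /gstep !inE.
by case: eqVneq => [->|_] /=; rewrite ?iI; lia.
Qed.

(** The second conclusion locates the innermost cochain on a subcell; it is needed when that cochain
    contains a further product, as in [cupseq_change]. *)
Lemma cupseq_neq0 chi s om x I : cupseq chi s om x I != 0 ->
  (forall k, k \in s -> exists y z, [/\ in_cell x I y, in_cell x I z & chi k y != chi k z])
  /\ exists y J, (forall z, in_cell y J z -> in_cell x I z) /\ om y J != 0.
Proof.
elim: s x I => [|k s IH] x I /=.
  by move=> h; split=> //; exists x, I.
rewrite /cup => /eqP h.
have [i iI]: exists2 i, i \in I & possign i I * ((chi k (gstep x i) - chi k x) *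
    cupseq chi s om (gstep x i) (I :\ i)) != 0.
  apply/exists_inP; apply: contraT => /exists_inPn H; case: h.
  by apply: big1 => i iI; apply/eqP/negPn/H.
rewrite !mulf_eq0 !negb_or => /and3P[_ dif /IH[H1 [y [J [yc oy]]]]].
split; last by exists y, J; split=> // z /yc; apply: in_cell_step.
move=> l; rewrite inE => /predU1P[->|/H1[y' [z' [yc' zc' ne]]]].
  exists (gstep x i), x; split; last by rewrite subr_eq0 in dif.
    move=> j; rewrite /gstep; case: eqVneq => [->|_] /=; rewrite ?iI; lia.
  exact: in_cell_refl.
by exists y', z'; split=> //; apply: in_cell_step; eassumption.
Qed.

Definition natpt M (x : {ffun 'I_n -> 'I_M}) : gridpt := fun i => x i.

Definition gdegree M (chi : 'I_n -> gridpt -> int) : int :=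
  \sum_(x : {ffun 'I_n -> 'I_M}) cupseq chi (enum 'I_n) cochain1 (natpt x) [set: 'I_n]%SET.

Definition facet_pt M i x :=
  (x i = 0%N \/ x i = M) /\ forall j, j != i -> (x j < M)%N.

Lemma stokes_eq0 M om :
  (forall i x, facet_pt M i x -> om x ([set: 'I_n]%SET :\ i) = 0) ->
  \sum_(x : {ffun 'I_n -> 'I_M}) cobound om (natpt x) [set: 'I_n]%SET = 0.
Proof.
(* For [M = 0] there are no cells if n > 0, and for n = 0 the coboundary is an empty sum. The cyclic
   shift used afterwards needs at least one index. *)
move=> om0; case: M om0 => [|M] om0.
  have [n0|n0] := posnP n.
    by rewrite big1 // => x _; rewrite /cobound big1 // => i; have := ltn_ord i; rewrite {2}n0.
  by rewrite big1 // => x; case: (x (Ordinal n0)).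
rewrite exchange_big /=; apply: big1 => i _.
rewrite -mulr_sumr sumrB.
(* Summing [om] over a face shift is a cyclic reindexing, since [om] vanishes on
   both faces. *)
pose cyc (f : 'I_M.+1 -> 'I_M.+1) (x : {ffun 'I_n -> 'I_M.+1}) :=
  [ffun j => if j == i then f (x j) else x j].
have cycK : cancel (cyc (@ordS _)) (cyc (@ord_pred _)).
  by move=> x; apply/ffunP => j; rewrite !ffunE; case: eqP => // _; rewrite ordSK.
have cycK' : cancel (cyc (@ord_pred _)) (cyc (@ordS _)).
  by move=> x; apply/ffunP => j; rewrite !ffunE; case: eqP => // _; rewrite ord_predK.
apply/eqP; rewrite mulf_eq0; apply/orP; right; rewrite subr_eq0; apply/eqP.
rewrite [RHS](reindex (cyc (@ordS _))) /=; last first.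
  by exists (cyc (@ord_pred _)) => x _; [exact: cycK | exact: cycK'].
apply: eq_bigr => x _; have := ltn_ord (x i); rewrite ltnS leq_eqVlt => /orP[/eqP xM|xM].
  rewrite [LHS](om0 i) ?[RHS](om0 i) //; split.
  - by left; rewrite /natpt ffunE eqxx /= xM modnn.
  - by move=> j _; exact: ltn_ord.
  - by right; rewrite /gstep /natpt eqxx xM addn1.
  - by move=> j /negbTE ji; rewrite /gstep /natpt ji addn0 ltn_ord.
congr om; apply/funext => j; rewrite /gstep /natpt ffunE.
by case: eqVneq => [->|_]; rewrite ?addn0 //= modn_small ?addn1.
Qed.

(** The two degrees differ by a sum of coboundaries, so only boundary facets count. A facet
    contributes only if all components other than j change on it and [chi j] differs from [chi' j]
    at some vertex of it, which the second hypothesis excludes. *)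
Lemma gdegree_change M chi chi' j : (forall k, k != j -> chi k = chi' k) ->
  (forall i x z, facet_pt M i x -> in_cell x ([set: 'I_n]%SET :\ i) z ->
     (forall k, k != j -> exists y y', [/\ in_cell x ([set: 'I_n]%SET :\ i) y,
        in_cell x ([set: 'I_n]%SET :\ i) y' & chi k y != chi k y']) ->
     chi j z = chi' j z) ->
  gdegree M chi = gdegree M chi'.
Proof.
move=> eqchi bd; apply/esym/eqP; rewrite -subr_eq0 /gdegree -sumrB.
have [s1 [s2 [es j1 j2]]] : exists s1 s2,
    [/\ enum 'I_n = s1 ++ j :: s2, j \notin s1 & j \notin s2].
  have jin : j \in enum 'I_n by rewrite mem_enum.
  have := enum_uniq 'I_n; case/splitPr: jin => s1 s2 /=.
  rewrite cat_uniq /= negb_or => /and4P[_ /andP[j1 _] j2 _].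
  by exists s1, s2.
have ins k : k != j -> (k \in s1) || (k \in s2).
  move=> kj; have : k \in enum 'I_n by rewrite mem_enum.
  by rewrite es mem_cat inE (negbTE kj).
rewrite es; under eq_bigr do rewrite cupseq_change //.
rewrite -mulr_sumr stokes_eq0 ?mulr0 // => i x fx.
apply/eqP; apply: contraT => /cupseq_neq0[H1 [z [J [zc]]]].
rewrite /cscale mulf_eq0 negb_or subr_eq0 => /andP[ne0 /cupseq_neq0[H2 _]].
case/eqP: ne0; apply/esym/(bd i x z fx (zc _ (in_cell_refl _ _))) => k kj.
have/orP[/H1 //|/H2[y [y' [yc yc' ne]]]] := ins k kj.
by exists y, y'; split=> //; exact: zc.
Qed.

(** Factor k can consume only direction k, since the k-th component is constant along all other
    edges. The list is increasing, so the consumed direction is always the least one left and every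
    sign is 1. *)
Lemma cupseq_separable (c : 'I_n -> nat -> int) s x I :
  sorted (fun i j : 'I_n => (i < j)%N) s ->
  cupseq (fun k y => c k (y k)) s cochain1 x I =
  (I == [set k in s])%:R * \prod_(k <- s) (c k (x k).+1 - c k (x k)).
Proof.
elim: s x I => [|k s IH] x I /= srt.
  by rewrite /cochain1 big_nil mulr1; congr (_ == _)%:R; apply/setP => k; rewrite !inE.
have lttr : transitive (fun i j : 'I_n => (i < j)%N) by move=> ? ? ? /ltn_trans; apply.
have kmin : forall l, l \in s -> (k < l)%N.
  by apply/allP; exact: order_path_min srt.
have ks : k \notin s by apply: contraT; rewrite negbK => /kmin; rewrite ltnn.
rewrite /cup.
have zero i : i \in I -> i != k -> possign i I *
   ((c k (gstep x i k) - c k (x k)) *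
    cupseq (fun k y => c k (y k)) s cochain1 (gstep x i) (I :\ i)) = 0.
  by move=> iI /negbTE ik; rewrite /gstep eq_sym ik addn0 subrr mul0r mulr0.
have [kI|kI] := boolP (k \in I); last first.
  rewrite big1 => [|i iI]; last by apply: zero => //; apply: contraNneq kI => <-.
  case: eqP => [eI|]; last by rewrite mul0r.
  by move: kI; rewrite eI !inE eqxx.
rewrite (bigD1 k) //= [X in _ + X]big1 ?addr0; last by move=> i /andP[]; exact: zero.
rewrite IH ?(path_sorted srt) // big_cons /gstep eqxx addn1.
have -> : \prod_(i <- s) (c i (x i + (i == k)).+1 - c i (x i + (i == k))%N) =
          \prod_(i <- s) (c i (x i).+1 - c i (x i)).
  by apply: eq_big_seq => i si; rewrite eq_sym (negbTE (memPnC ks _ si)) addn0.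
have -> : (I == [set i in k :: s]) = (I :\ k == [set i in s]).
  apply/eqP/eqP => [->|e]; apply/setP => i.
    by rewrite !inE; case: eqVneq => //= ->; rewrite (negbTE ks).
  move/setP/(_ i): e; rewrite !inE; case: eqVneq => [->|] //= ; by rewrite kI.
case: eqP => [e|]; last by rewrite !mul0r !mulr0.
have -> : possign k I = 1.
  rewrite /possign; have -> : [set j in I | (j < k)%N] = finset.set0; last by rewrite cards0.
  apply/setP => j; rewrite !inE; apply/negP => /andP[jI jk].
  have : j \in I :\ k by rewrite !inE jI andbT; apply: contraTneq jk => ->; rewrite ltnn.
  by rewrite e inE => /kmin; rewrite ltnNge ltnW.
by rewrite !mul1r.
Qed.

(** By distributivity the sum over cells is a product of one-dimensional sums, and each of them
    telescopes. *)
Lemma gdegree_separable M (c : 'I_n -> nat -> int) :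
  gdegree M (fun k y => c k (y k)) = \prod_k (c k M - c k 0%N).
Proof.
have srt : sorted (fun i j : 'I_n => (i < j)%N) (enum 'I_n).
  by have := iota_ltn_sorted 0 n; rewrite -val_enum_ord sorted_map.
rewrite /gdegree (eq_bigr (fun x : {ffun 'I_n -> 'I_M} =>
    \prod_k (c k (x k).+1 - c k (x k)))); last first.
  move=> x _; rewrite (cupseq_separable c _ _ srt).
  have -> : [set k in enum 'I_n] = [set: 'I_n]%SET by apply/setP => k; rewrite !inE mem_enum.
  by rewrite eqxx mul1r big_enum.
rewrite -(bigA_distr_bigA (fun k (m : 'I_M) => c k m.+1 - c k m)) /=.
by apply: eq_bigr => k _; rewrite -(big_mkord xpredT (fun m => c k m.+1 - c k m)) telescope_sumr.
Qed.

Lemma cupseq_shift chi (lo : gridpt) s x I :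
  cupseq (fun k y => chi k (fun i => lo i + y i)%N) s cochain1 x I =
  cupseq chi s cochain1 (fun i => lo i + x i)%N I.
Proof.
elim: s x I => //= k s IH x I; rewrite /cup; apply: eq_bigr => i _.
have e : (fun j => lo j + gstep x i j)%N = gstep (fun j => lo j + x j)%N i.
  by apply/funext => j; rewrite /gstep addnA.
by rewrite IH e.
Qed.

End Cochains.

(** * Homotopy invariance for signs of real components *)

Section MetricHomotopy.
Variables (R : realDomainType) (n : nat).

Definition signs (g : gridpt n -> 'I_n -> R) : 'I_n -> gridpt n -> int :=
  fun k x => (0 < g x k)%R%:R.

Definition box_bdry M (x : gridpt n) :=
  (forall i, (x i <= M)%N) /\ exists i, x i = 0%N \/ x i = M.

Definition cell_adjacent (x y : gridpt n) :=
  exists z, in_cell z [set: 'I_n]%SET x /\ in_cell z [set: 'I_n]%SET y.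

Lemma sign_change_le (a b e : R) : `|a - b| <= e ->
  (0 < a)%R%:R != (0 < b)%R%:R :> int -> `|a| <= e.
Proof.
rewrite !ler_norml; case: (ltrP 0 a) => a0; case: (ltrP 0 b) => b0 //= + _; lra.
Qed.

(** The origin of the constant 5: [a'] and [b'] are perturbed values at two vertices, so they are at
    most 3 e apart and a sign change makes [a'] at most 3 e; undoing the perturbation and moving to
    the third vertex, with value [z], cost e each. *)
Lemma change_bound (a a' b b' z e : R) : `|a' - a| <= e -> `|b' - b| <= e ->
  `|z - a| <= e -> `|a - b| <= e ->
  (0 < a')%R%:R != (0 < b')%R%:R :> int -> `|z| <= 5 * e.
Proof.
rewrite !ler_norml => h1 h2 h3 h4 /(sign_change_le (e := 3 * e)).
by rewrite !ler_norml => /(_ ltac:(lra)); lra.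
Qed.

Lemma facet_cell_bdry M i x z : facet_pt M i x -> in_cell x ([set: 'I_n]%SET :\ i) z ->
  @box_bdry M z.
Proof.
move=> [xi xj] zc; split=> [j|]; last first.
  by exists i; move: (zc i); rewrite !inE eqxx /=; lia.
move: (zc j); rewrite !inE; case: eqVneq => [->|ji] /=; first by lia.
by have := xj _ ji; lia.
Qed.

Lemma gdegree_homotopy M (g g' : gridpt n -> 'I_n -> R) (e : R) :
  (forall z k, box_bdry M z -> `|g' z k - g z k| <= e) ->
  (forall y z k, box_bdry M y -> box_bdry M z -> cell_adjacent y z -> `|g y k - g z k| <= e) ->
  (forall z, box_bdry M z -> exists k, 5 * e < `|g z k|) ->
  gdegree M (signs g) = gdegree M (signs g').
Proof.
move=> gg' osc g5.
(* Exchange the components one at a time: where component [m] changes sign, a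
   facet in the support makes all other components small as well. *)
pose h (m : nat) : gridpt n -> 'I_n -> R := fun z k => if (k < m)%N then g' z k else g z k.
suff H m : (m <= n)%N -> gdegree M (signs g) = gdegree M (signs (h m)).
  rewrite (H n) //; congr (gdegree M (signs _)); apply/funext => z; apply/funext => k.
  by rewrite /h ltn_ord.
elim: m => [|m IH] mn.
  by congr (gdegree M (signs _)); apply/funext => z; apply/funext => k.
rewrite IH ?(ltnW mn) //; apply: (@gdegree_change _ _ _ _ (Ordinal mn)).
  move=> k km; apply/funext => z; rewrite /signs /h.
  have -> // : (k < m.+1)%N = (k < m)%N.
  rewrite ltnS leq_eqVlt orb_idl // => /eqP ke; case/eqP: km; exact: val_inj.
move=> i x z fx zc Hk; apply/eqP; apply: contraT => ne.
have zb := facet_cell_bdry fx zc.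
have [k] := g5 z zb.
have inT y : in_cell x ([set: 'I_n]%SET :\ i) y -> in_cell x [set: 'I_n]%SET y.
  by move=> yc j; have := yc j; rewrite !inE; case: (_ == _) => /=; lia.
have e0 : 0 <= e by apply: le_trans (normr_ge0 _) (gg' z k zb).
rewrite real_ltNge ?num_real // => /negP; case.
have [->|/Hk[y [y' [yc yc']]]] := eqVneq k (Ordinal mn).
  have ge : `|g z (Ordinal mn) - g' z (Ordinal mn)| <= e by rewrite distrC gg'.
  move: ne; rewrite /signs /h /= ltnn ltnSn => /(sign_change_le ge) gz.
  by apply: le_trans gz _; rewrite ler_peMl // ler1n.
have yb := facet_cell_bdry fx yc; have yb' := facet_cell_bdry fx yc'.
have yy' : cell_adjacent y y' by exists x; split; exact: inT.
have zy : cell_adjacent z y by exists x; split; exact: inT.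
(* Components already exchanged are seen through [g']; for the others [change_bound] is used with
   zero perturbation. *)
rewrite /signs /h; case: ifP => _.
  exact: (change_bound (gg' y k yb) (gg' y' k yb') (osc _ _ k zb yb zy) (osc _ _ k yb yb' yy')).
have o0 : `|g y k - g y k| <= e by rewrite subrr normr0.
have o0' : `|g y' k - g y' k| <= e by rewrite subrr normr0.
exact: (change_bound o0 o0' (osc _ _ k zb yb zy) (osc _ _ k yb yb' yy')).
Qed.

End MetricHomotopy.

(** * The degree of a map on a grid *)

Section RowNorm.
Variables (R : realType) (n : nat).
Implicit Types x y : 'rV[R]_n.

Lemma coord_le_norm x i : `|x 0 i| <= `|x|.
Proof.
rewrite [leRHS]/Num.norm /= mx_normrE; apply/bigmax_geP; right.
by exists (0, i).
Qed.

Lemma row_norm_le x c : 0 <= c -> (forall i, `|x 0 i| <= c) -> `|x| <= c.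
Proof.
move=> c0 H; rewrite [leLHS]/Num.norm /= mx_normrE; apply/bigmax_leP; split=> // -[i j] _ /=.
by rewrite (ord1 i).
Qed.

Lemma row_norm_lt x c : 0 < c -> (forall i, `|x 0 i| < c) -> `|x| < c.
Proof.
move=> c0 H; rewrite [ltLHS]/Num.norm /= mx_normrE; apply/bigmax_ltP; split=> // -[i j] _ /=.
by rewrite (ord1 i).
Qed.

Lemma row_norm_gt x c : 0 <= c -> c < `|x| -> exists i, c < `|x 0 i|.
Proof.
move=> c0; apply: contraPP => /forallNP H; apply/negP; rewrite -leNgt.
by apply: row_norm_le => // i; rewrite leNgt; apply/negP.
Qed.

End RowNorm.

Section Compactness.
Variable R : realType.

Lemma compact_pos_lb (T : topologicalType) (K : set T) (f : T -> R) :
  compact K -> continuous f -> (forall x, K x -> 0 < f x) ->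
  exists2 m, 0 < m & forall x, K x -> m <= f x.
Proof.
move=> cK cf fpos; have [K0|/set0P/negP] := pselect (K !=set0); last first.
  by rewrite negbK => /eqP ->; exists 1.
have [c cK' fc] := compact_EVT_min K0 cK (continuous_subspaceT cf).
exists (f c); first by apply: fpos; rewrite inE in cK'.
by move=> x Kx; apply: fc; rewrite inE.
Qed.

(** Only [x] is confined to [K]; halving the radii of the cover leaves room for an arbitrary nearby
    [y]. *)
Lemma compact_unif_cont (U V : normedModType R) (K : set U) (f : U -> V) (e : R) :
  compact K -> continuous f -> 0 < e ->
  exists2 d, 0 < d & forall x y, K x -> `|x - y| < d -> `|f x - f y| < e.
Proof.
move=> /compact_near_coveringP cK cf e0.
have : \forall d \near 0^'+, forall x, K x ->
    forall y, `|x - y| < d -> `|f x - f y| < e.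
  apply: (cK R (0^'+) (fun d x => forall y, `|x - y| < d -> `|f x - f y| < e)) => x Kx.
  have : \forall y \near x, `|f x - f y| < e / 2.
    by have /cvgrPdist_lt := cf x; apply; rewrite divr_gt0.
  move=> /nbhs_ballP[d d0 Hd].
  exists (ball x (d / 2), [set t | t < d / 2]) => /=.
    split; first exact/nbhsx_ballx/divr_gt0.
    by apply: nbhs_right_lt; rewrite divr_gt0.
  move=> [x' t] /= [xx' td] y yt.
  move: xx'; rewrite -ball_normE /= => xx'.
  have h1 : `|f x - f x'| < e / 2.
    by apply: Hd; rewrite -ball_normE /=; apply: (lt_trans xx'); rewrite gtr_pMr //; lra.
  have h2 : `|f x - f y| < e / 2.
    apply: Hd; rewrite -ball_normE /=.
    rewrite (_ : x - y = (x - x') + (x' - y)); last by rewrite addrA subrK.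
    by apply: (le_lt_trans (ler_normD _ _)); lra.
  rewrite (_ : f x' - f y = (f x - f y) - (f x - f x')); last first.
    by rewrite opprB [RHS]addrC addrA subrK.
  by apply: (le_lt_trans (ler_normB _ _)); lra.
move=> [/= d d0 Hd]; exists (d / 2); first by rewrite divr_gt0.
move=> x y Kx; apply: (Hd (d / 2)) => //=; last by rewrite divr_gt0.
by rewrite sub0r normrN gtr0_norm ?divr_gt0 // gtr_pMr //; lra.
Qed.
End Compactness.

Lemma compact_ub (R : realType) (T : topologicalType) (K : set T) (f : T -> R) :
  compact K -> continuous f -> exists2 B, 0 < B & forall x, K x -> f x <= B.
Proof.
move=> cK cf; have [K0|/set0P/negP] := pselect (K !=set0); last first.
  by rewrite negbK => /eqP ->; exists 1.
have [c cK' fc] := compact_EVT_max K0 cK (continuous_subspaceT cf).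
exists (Num.max 1 (f c)); first by rewrite lt_max ltr01.
by move=> x Kx; rewrite le_max fc ?orbT // inE.
Qed.

Section GridDegree.
Variables (R : realType) (n : nat).
Implicit Types (b : 'rV[R]_n) (h : R) (G : 'rV[R]_n -> 'rV[R]_n).

Definition gpos b h (x : gridpt n) : 'rV[R]_n := \row_i (b 0 i + h * (x i)%:R).

Definition grid_signs b h G : 'I_n -> gridpt n -> int :=
  signs (fun x k => G (gpos b h x) 0 k).

Definition grid_degree b h M G : int := gdegree M (grid_signs b h G).

Lemma gpos_adjacent b h x y : 0 <= h -> cell_adjacent x y ->
  `|gpos b h x - gpos b h y| <= h.
Proof.
move=> h0 [z [zx zy]]; apply: row_norm_le => // i.
rewrite !mxE opprD addrACA subrr add0r -mulrBr normrM ger0_norm //.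
apply: ler_piMr => //; move: (zx i) (zy i); rewrite !inE addn1 => /andP[x1 x2] /andP[y1 y2].
have [e|e] := leqP (y i) (x i).
  by rewrite -natrB // normr_nat (ler_nat _ _ 1); lia.
by rewrite distrC -natrB 1?ltnW // normr_nat (ler_nat _ _ 1); lia.
Qed.

Lemma convex_coord_diff (t : R) (u u' v v' : 'rV[R]_n) (e : R) k :
  0 <= t <= 1 -> `|u - u'| < e -> `|v - v'| < e ->
  `|((1 - t) *: u + t *: v) 0 k - ((1 - t) *: u' + t *: v') 0 k| <= e.
Proof.
move=> /andP[t0 t1] /ltW hu /ltW hv.
have := le_trans (coord_le_norm (u - u') k) hu.
have := le_trans (coord_le_norm (v - v') k) hv.
rewrite !mxE => hv' hu'.
rewrite (_ : _ - _ = (1 - t) * (u 0 k - u' 0 k) + t * (v 0 k - v' 0 k)); last by ring.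
apply: le_trans (ler_normD _ _) _; rewrite !normrM (ger0_norm t0) ger0_norm ?subr_ge0 //.
apply: (@le_trans _ _ ((1 - t) * e + t * e)); last by rewrite -mulrDl subrK mul1r.
by rewrite lerD // ler_wpM2l // subr_ge0.
Qed.

(** [h0] is chosen before the box. This uniformity is essential near a zero, where the box is cut
    out of a given grid and its position therefore depends on the mesh. *)
Lemma grid_degree_homotopy (K : set 'rV[R]_n) (H0 H1 : 'rV[R]_n -> 'rV[R]_n) :
  compact K -> continuous H0 -> continuous H1 ->
  (forall t x, 0 <= t <= 1 -> K x -> (1 - t) *: H0 x + t *: H1 x != 0) ->
  exists2 h0, 0 < h0 & forall h b M, 0 < h < h0 ->
    (forall x, box_bdry M x -> K (gpos b h x)) ->
    grid_degree b h M H0 = grid_degree b h M H1.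
Proof.
move=> cK c0 c1 ne0.
have cHt : continuous (fun p : R * 'rV[R]_n => `|(1 - p.1) *: H0 p.2 + p.1 *: H1 p.2|).
  move=> p; apply: cvg_norm; apply: cvgD; apply: cvgZ.
  - by apply: cvgB; [exact: cvg_cst | exact: cvg_fst].
  - by apply: continuous_comp; [exact: cvg_snd | exact: c0].
  - exact: cvg_fst.
  - by apply: continuous_comp; [exact: cvg_snd | exact: c1].
have [|m m0 Hm] := compact_pos_lb (compact_setX (@segment_compact R 0 1) cK) cHt.
  move=> [t x] [/=]; rewrite in_itv /= => t01 Kx.
  by rewrite normr_gt0 ne0.
have cD : continuous (fun x : 'rV[R]_n => `|H1 x - H0 x|).
  by move=> x; exact: cvg_norm (cvgB (c1 x) (c0 x)).
have [B B0 HB] := compact_ub cK cD.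
(* [gdegree_homotopy] asks for boundary values above 5 e, and [m] bounds them from below. *)
pose e := m / 6; have e0 : 0 < e by rewrite divr_gt0.
have [d0 d00 Hd0] := compact_unif_cont cK c0 e0.
have [d1 d10 Hd1] := compact_unif_cont cK c1 e0.
exists (Num.min d0 d1); first by rewrite lt_min d00.
move=> h b M /andP[h0]; rewrite lt_min => /andP[hd0 hd1] bK.
(* Number of time steps: each one moves a boundary value by at most B / T <= e. *)
pose T := (Num.truncn (B / e)).+1.
have BT : B / T%:R <= e.
  by rewrite ler_pdivrMr ?ltr0n // mulrC -ler_pdivrMr // ltW // truncnS_gt.
pose Ht (k : nat) x := (1 - k%:R / T%:R) *: H0 x + (k%:R / T%:R) *: H1 x.
suff H k : (k <= T)%N -> grid_degree b h M H0 = grid_degree b h M (Ht k).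
  rewrite (H T) //; congr grid_degree; apply/funext => x.
  by rewrite /Ht divff ?pnatr_eq0 // subrr scale0r add0r scale1r.
elim: k => [|k IH] kT.
  by congr grid_degree; apply/funext => x; rewrite /Ht mul0r subr0 scale0r addr0 scale1r.
rewrite IH ?(ltnW kT) //.
have t01 : 0 <= (k%:R / T%:R : R) <= 1.
  by rewrite divr_ge0 //= ler_pdivrMr ?ltr0n // mul1r ler_nat ltnW.
apply: (@gdegree_homotopy _ _ _ _ _ e).
- move=> z i zb; rewrite /Ht !mxE.
  have := coord_le_norm (H1 (gpos b h z) - H0 (gpos b h z)) i.
  have := HB _ (bK _ zb); rewrite !mxE => h1 h2.
  rewrite (_ : _ - _ = (H1 (gpos b h z) 0 i - H0 (gpos b h z) 0 i) / T%:R).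
    rewrite normrM normfV normr_nat; apply: le_trans BT.
    by rewrite ler_wpM2r ?invr_ge0 //; apply: le_trans h2 h1.
  have T0 : T%:R != 0 :> R by rewrite pnatr_eq0.
  by rewrite -[k.+1%:R]natr1; field.
- move=> y z i yb zb adj; apply: convex_coord_diff => //.
    by apply: Hd0 (bK _ yb) _; apply: le_lt_trans (gpos_adjacent _ (ltW h0) adj) _.
  by apply: Hd1 (bK _ yb) _; apply: le_lt_trans (gpos_adjacent _ (ltW h0) adj) _.
- move=> z zb; apply: row_norm_gt; first by rewrite mulr_ge0 // ltW.
  apply: (@lt_le_trans _ _ m); first by rewrite /e; lra.
  by apply: (Hm (k%:R / T%:R, gpos b h z)); split=> /=; [rewrite in_itv | exact: bK].
Qed.

(** Each component takes different signs at two vertices of the cell, so at one of them its sign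
    differs from that at the lowest vertex; the oscillation then bounds the value there. *)
Lemma grid_support b h G x (e : R) : 0 <= e ->
  (forall y, in_cell x [set: 'I_n]%SET y -> `|G (gpos b h x) - G (gpos b h y)| <= e) ->
  cupseq (grid_signs b h G) (enum 'I_n) (@cochain1 n) x [set: 'I_n]%SET != 0 ->
  `|G (gpos b h x)| <= e.
Proof.
move=> e0 osc /cupseq_neq0[H _]; apply: row_norm_le => // k.
have [|y [z [yc zc]]] := H k; first by rewrite mem_enum.
have oscy w : in_cell x [set: 'I_n]%SET w -> `|G (gpos b h x) 0 k - G (gpos b h w) 0 k| <= e.
  by move=> /osc; apply: le_trans; have := coord_le_norm (G (gpos b h x) - G (gpos b h w)) k; rewrite !mxE.
rewrite /grid_signs /signs; set sx : int := (0 < G (gpos b h x) 0 k)%R%:R => ne.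
have [exy|exy] := eqVneq sx (0 < G (gpos b h y) 0 k)%R%:R; last exact: sign_change_le (oscy _ yc) exy.
by apply: (sign_change_le (oscy _ zc)); rewrite -/sx exy.
Qed.

End GridDegree.

(** * Local degree at a regular zero *)

Section LinearDegree.
Variables (R : realType) (n : nat).
Implicit Types (a b v : 'rV[R]_n) (A B : 'M[R]_n) (d : 'rV[R]_n).

Definition annulus a (rho : R) : set 'rV[R]_n :=
  [set x | rho / 2 <= `|x - a| <= rho].

(** The boxes are not centred at [a], because they must be made of cells of a grid in which [a] need
    not be a vertex. The last condition puts [a] strictly inside: a box lying entirely within the
    annulus would satisfy the boundary condition too. *)
Definition has_local_degree a (G : 'rV[R]_n -> 'rV[R]_n) (rho : R) (deg : int) :=
  exists2 h0, 0 < h0 & forall h b M, 0 < h < h0 ->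
    (forall x, box_bdry M x -> annulus a rho (gpos b h x)) ->
    (forall i, b 0 i < a 0 i < b 0 i + h * M%:R) ->
    grid_degree b h M G = deg.

Lemma norm_continuous_sub a : continuous (fun x : 'rV[R]_n => `|x - a|).
Proof. by move=> x; exact: cvg_norm (cvgB cvg_id (cvg_cst _)). Qed.

Lemma compact_annulus a rho : compact (annulus a rho).
Proof.
apply: bounded_closed_compact.
  exists (rho + `|a|); split; first exact: num_real.
  move=> M lM x /= /andP[_ xr]; apply: le_trans (ltW lM).
  by rewrite -[x](subrK a); apply: le_trans (ler_normD _ _) _; rewrite lerD2r.
have -> : annulus a rho = (fun x => `|x - a|) @^-1` `[rho / 2, rho]%classic.
  by apply/seteqP; split=> x /=; rewrite in_itv.
apply: preimage_closed; last exact: itv_closed.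
by move=> x _; exact: norm_continuous_sub.
Qed.

Lemma has_local_degree_homotopy a (G0 G1 : 'rV[R]_n -> 'rV[R]_n) rho deg : continuous G0 -> continuous G1 ->
  (forall t x, 0 <= t <= 1 -> annulus a rho x -> (1 - t) *: G0 x + t *: G1 x != 0) ->
  has_local_degree a G0 rho deg -> has_local_degree a G1 rho deg.
Proof.
move=> c0 c1 ne [h0 h00 H0].
have [h1 h10 H1] := grid_degree_homotopy (@compact_annulus a rho) c0 c1 ne.
exists (Num.min h0 h1); first by rewrite lt_min h00.
move=> h b M /andP[hp]; rewrite lt_min => /andP[hh0 hh1] bK bi.
by rewrite -(H1 h b M) ?hp // H0 ?hp.
Qed.

Definition lin_at a A : 'rV[R]_n -> 'rV[R]_n := fun x => (x - a) *m A.

Lemma mulmxr_continuous A : continuous (fun x : 'rV[R]_n => x *m A).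
Proof.
have -> : (fun x : 'rV[R]_n => x *m A) = fun x => \sum_i x 0 i *: row i A.
  by apply/funext => x; rewrite mulmx_sum_row.
apply: continuous_big; first exact: add_continuous.
by move=> i _ x; exact: (cvgZr_tmp (@coord_continuous R 1 n 0 i x)).
Qed.

Lemma lin_at_continuous a A : continuous (lin_at a A).
Proof.
have -> : lin_at a A = fun x => x *m A - a *m A.
  by apply/funext => x; rewrite /lin_at mulmxBl.
by move=> x; exact: (cvgB (@mulmxr_continuous A x) (cvg_cst _)).
Qed.

Definition lin_degree A := forall a rho, 0 < rho ->
  has_local_degree a (lin_at a A) rho (sgz (\det A)).

Lemma lin_degree_segment A B :
  (forall t v, 0 <= t <= 1 -> v *m ((1 - t) *: A + t *: B) = 0 -> v = 0) ->
  \det A = \det B -> lin_degree A -> lin_degree B.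
Proof.
move=> inj eqdet lA a rho rho0; rewrite -eqdet.
apply: has_local_degree_homotopy (lA a rho rho0); try exact: lin_at_continuous.
move=> t x t01 /= /andP[xa _]; apply/eqP.
rewrite /lin_at !scalemxAr -mulmxDr => /(inj _ _ t01)/eqP.
rewrite subr_eq0 => /eqP xe; move: xa; rewrite xe subrr normr0; lra.
Qed.

(** The map is separable, and component k changes sign exactly once between the two faces since [a]
    lies strictly between them. Any mesh will do, so the bound 1 is arbitrary. *)
Lemma lin_degree_diag d : (forall i, d 0 i != 0) -> lin_degree (diag_mx d).
Proof.
move=> d0 a rho rho0; exists 1 => // h b M _ _ ab.
pose c (k : 'I_n) (m : nat) : int := (0 < (b 0 k + h * m%:R - a 0 k) * d 0 k)%R%:R.
have -> : grid_degree b h M (lin_at a (diag_mx d)) = gdegree M (fun k y => c k (y k)).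
  congr gdegree; apply/funext => k; apply/funext => y.
  by rewrite /grid_signs /signs /lin_at mul_mx_diag !mxE.
rewrite gdegree_separable det_diag (big_morph _ (@sgzM R) (@sgz1 R)).
apply: eq_bigr => k _; have /andP[ab1 ab2] := ab k.
rewrite /c mulr0 addr0; have [dk|dk|/eqP] := ltgtP 0 (d 0 k); last by rewrite eq_sym (negbTE (d0 k)).
  by rewrite (gtr0_sgz dk) !pmulr_lgt0 // !subr_gt0 ab2 ltNge ltW.
by rewrite (ltr0_sgz dk) !nmulr_lgt0 // !subr_lt0 ab1 ltNge ltW.
Qed.

Lemma det_neq0_inj A v : \det A != 0 -> v *m A = 0 -> v = 0.
Proof.
rewrite -unitfE -[_ \is a _]/(A \in unitmx) => uA /(congr1 (fun u => u *m invmx A)).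
by rewrite mulmxK // mul0mx.
Qed.

(* Exchanging rows (a, b) into (b, a) while keeping the determinant's sign: the
   segment from (a, -b) to (b, a) consists of invertible matrices. *)
Lemma lin_degree_perm (s : 'S_n) d : (forall i, d 0 i != 0) ->
  lin_degree (perm_mx s *m diag_mx d).
Proof.
have [ts -> /allP tsP] := prod_tpermP s.
elim: ts tsP d => [_ d d0|[i j] ts IH tsP d d0].
  by rewrite big_nil perm_mx1 mul1mx; exact: lin_degree_diag.
have ij : i != j by have /= := tsP (i, j); rewrite inE eqxx => /(_ isT).
have {}IH := IH (fun t H => tsP t (mem_behead (s := (i, j) :: ts) H)).
rewrite big_cons /= perm_mxM -mulmxA; move: IH; set s' := (\prod_(_ <- _) _)%g => IH.
(* Flipping coordinate j makes up for the determinant -1 of the transposition. Moved past the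
   permutation, the flip is absorbed into the diagonal, which is why the induction runs over all
   [d]. *)
pose N : 'rV[R]_n := \row_k (-1) ^+ (k == j).
pose d' : 'rV[R]_n := \row_k (d 0 k * N 0 (s'^-1 k)%g).
have eN : diag_mx N *m (perm_mx s' *m diag_mx d) = perm_mx s' *m diag_mx d'.
  apply/matrixP => k l; rewrite mul_diag_mx !mul_mx_diag !mxE.
  case: (eqVneq (s' k) l) => [<-|_]; last by rewrite !mul0r mulr0.
  by rewrite permK !mul1r mulrC.
apply: lin_degree_segment (IH d' _); last first.
- by move=> k; rewrite !mxE mulf_neq0 // signr_eq0.
- rewrite -eN !det_mulmx det_diag; congr (_ * _).
  rewrite det_perm odd_tperm ij expr1 (bigD1 j) //= mxE eqxx expr1 big1 ?mulr1 //.
  by move=> k /negbTE kj; rewrite mxE kj.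
move=> t v t01; rewrite -eN !scalemxAl -mulmxDl mulmxA => /det_neq0_inj H.
have {}/H : \det (perm_mx s' *m diag_mx d) != 0.
  by rewrite det_mulmx det_perm det_diag mulf_neq0 ?signr_eq0 //; apply/prodf_neq0.
rewrite mulmxDr -!scalemxAr => /rowP H.
have Hk k : (1 - t) * (v 0 k * (-1) ^+ (k == j)) + t * v 0 (tperm i j k) = 0.
  have := H k; rewrite mul_mx_diag -[tperm i j in LHS]invgK tpermV -col_permE !mxE.
  by [].
(* Up to sign, the determinant of the two equations [Hi] and [Hj] in the unknowns [v 0 i] and
   [v 0 j]. *)
have sq0 : (1 - t) ^+ 2 + t ^+ 2 != 0 by apply/eqP; nra.
have := Hk i; have := Hk j; rewrite eqxx (negbTE ij) tpermL tpermR expr0 expr1 => Hj Hi.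
apply/rowP => k; rewrite mxE.
have [->|ki] := eqVneq k i.
  apply: (mulfI sq0); rewrite mulr0.
  rewrite (_ : _ * _ = (1 - t) * ((1 - t) * (v 0 i * 1) + t * v 0 j)
    + t * ((1 - t) * (v 0 j * -1) + t * v 0 i)); last by ring.
  by rewrite Hj Hi !mulr0 addr0.
have [->|kj] := eqVneq k j.
  apply: (mulfI sq0); rewrite mulr0.
  rewrite (_ : _ * _ = t * ((1 - t) * (v 0 i * 1) + t * v 0 j)
    - (1 - t) * ((1 - t) * (v 0 j * -1) + t * v 0 i)); last by ring.
  by rewrite Hj Hi !mulr0 subr0.
by have := Hk k; rewrite (negbTE kj) tpermD 1?eq_sym // expr0 mulr1 -mulrDl subrK mul1r.
Qed.

End LinearDegree.

Lemma det_upper (R : realType) n (U : 'M[R]_n) :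
  (forall i j : 'I_n, (j < i)%N -> U i j = 0) -> \det U = \prod_i U i i.
Proof.
move=> H; rewrite -det_tr det_trig; first by apply: eq_bigr => i _; rewrite mxE.
by apply/is_trig_mxP => i j ij; rewrite mxE H.
Qed.

(** LUP decomposition: the diagonal of U is joined to U through upper triangular matrices with the
    same diagonal, then the identity to L through unit lower triangular ones. The determinant is
    constant along both segments. *)
Lemma lin_degree_unit (R : realType) n (A : 'M[R]_n.+1) : \det A != 0 -> lin_degree A.
Proof.
move=> dA.
have := cormen_lup_correct A; have := cormen_lup_perm A.
have := @cormen_lup_lower _ _ A; have := @cormen_lup_upper _ _ A.
have := cormen_lup_detL A.
case: (cormen_lup A) => [[P L] U] /= detL Uup Llo /is_perm_mxP[s ->] PA.
pose p := perm_mx s^-1 : 'M[R]_n.+1.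
have eA : A = p *m (L *m U).
  by rewrite -[L *m U]/(L * U) -PA mulmxA /p -perm_mxM mulVg perm_mx1 mul1mx.
have detp : \det p != 0 by rewrite det_perm signr_eq0.
have detU : \det U != 0.
  by apply: contraNneq dA => dU; rewrite eA !det_mulmx dU !mulr0.
have U0 i : U i i != 0.
  by move: detU; rewrite (det_upper Uup) => /prodf_neq0; apply.
pose D : 'rV[R]_n.+1 := \row_i U i i.
have goodD : lin_degree (p *m diag_mx D).
  by apply: lin_degree_perm => i; rewrite mxE.
have goodU : lin_degree (p *m U).
  apply: lin_degree_segment goodD.
    move=> t v t01; rewrite !scalemxAr -mulmxDr; apply: det_neq0_inj.
    rewrite det_mulmx mulf_neq0 // det_upper.
      apply/prodf_neq0 => i _; rewrite !mxE eqxx mulr1n -mulrDl subrK mul1r; exact: U0.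
    move=> i j ji; rewrite !mxE (Uup _ _ ji) mulr0 addr0.
    by case: eqVneq ji => [->|_ _]; rewrite ?ltnn // mulr0n mulr0.
  by rewrite !det_mulmx det_diag (det_upper Uup); congr (_ * _); apply: eq_bigr => i _; rewrite mxE.
rewrite eA; apply: lin_degree_segment goodU.
  move=> t v t01.
  have -> : (1 - t) *: (p *m U) + t *: (p *m (L *m U)) =
            p *m (((1 - t) *: 1%:M + t *: L) *m U).
    by rewrite mulmxDl -!scalemxAl mul1mx mulmxDr -!scalemxAr.
  apply: det_neq0_inj; rewrite !det_mulmx !mulf_neq0 // det_trig.
    apply/prodf_neq0 => i _; rewrite !mxE Llo // eqxx mulr1n !mulr1 subrK; exact: oner_neq0.
  apply/is_trig_mxP => i j ij.
  have nij : (i == j) = false by apply/negbTE; apply: contraTneq ij => ->; rewrite ltnn.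
  rewrite !mxE (Llo _ _ (ltnW ij)).
  by rewrite nij mulr0n !mulr0 addr0.
by rewrite !det_mulmx detL mul1r.
Qed.

Lemma mulmx_norm_le (R : realType) n (B : 'M[R]_n) :
  exists2 C, 0 < C & forall u : 'rV[R]_n, `|u *m B| <= C * `|u|.
Proof.
pose C := 1 + \sum_i \sum_j `|B i j|.
have S0 i : 0 <= \sum_j `|B i j| by apply: sumr_ge0.
have C0 : 0 < C by rewrite ltr_pwDl // sumr_ge0.
exists C => // u; apply: row_norm_le; first by rewrite mulr_ge0 // ltW.
move=> j; rewrite mxE; apply: le_trans (ler_norm_sum _ _ _) _.
rewrite /C mulrDl mul1r mulr_suml ler_wpDl // ler_sum // => i _.
rewrite normrM mulrC ler_pM // ?coord_le_norm //.
by rewrite (bigD1 j) //= lerDl sumr_ge0.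
Qed.

(** If C bounds the inverse of the Jacobian, the linear part has norm at least |x - a| / C. Near [a]
    the remainder is at most half of that, so no map on the segment from the linearisation to [G]
    vanishes there, except at [a]. *)
Lemma regular_zero (R : realType) n (G : 'rV[R]_n.+1 -> 'rV[R]_n.+1) a :
  continuous G -> differentiable G a -> G a = 0 -> \det ('J G a) != 0 ->
  exists2 rho0, 0 < rho0 &
    (forall rho, 0 < rho <= rho0 -> has_local_degree a G rho (sgz (\det ('J G a))))
    /\ (forall x, 0 < `|x - a| <= rho0 -> G x != 0).
Proof.
move=> cG dG Ga0; set A := 'J G a => dA.
have uA : A \in unitmx by rewrite unitmxE unitfE.
have [C C0 HC] := mulmx_norm_le (invmx A).
have lbA (v : 'rV[R]_n.+1) : `|v| <= C * `|v *m A| by have := HC (v *m A); rewrite mulmxK.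
have /eqaddoP/(_ (1 / (2 * C))) := diff_locally dG.
have eC0 : 0 < 1 / (2 * C) by rewrite divr_gt0 // mulr_gt0.
move=> /(_ eC0) /nbhs_ballP[/= r r0 Hr].
have approx x : `|x - a| < r -> `|G x - lin_at a A x| <= 1 / (2 * C) * `|x - a|.
  move=> xa; have := Hr (x - a); rewrite /= -ball_normE /= sub0r normrN => /(_ xa).
  rewrite /= /cst fctE /= subrK Ga0 add0r /lin_at.
  by rewrite /A /jacobian mul_rV_lin1.
have convex_ne0 t x : 0 <= t <= 1 -> 0 < `|x - a| <= r / 2 ->
    (1 - t) *: lin_at a A x + t *: G x != 0.
  move=> /andP[t0 t1] /andP[xa0 xar]; apply/eqP => e0.
  have xar' : `|x - a| < r by apply: le_lt_trans xar _; rewrite ltr_pdivrMr // ltr_pMr // ltr1n.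
  have eq1 : lin_at a A x = - (t *: (G x - lin_at a A x)).
    apply/eqP; rewrite -addr_eq0 -e0 scalerBr scalerBl scale1r addrA.
    by rewrite addrAC.
  have := lbA (x - a); rewrite -/(lin_at a A x) eq1 normrN normrZ ger0_norm //.
  have h1 : t * `|G x - lin_at a A x| <= 1 / (2 * C) * `|x - a|.
    by apply: le_trans (approx _ xar'); rewrite ler_piMl.
  move=> h2; have : `|x - a| <= C * (1 / (2 * C) * `|x - a|).
    by apply: le_trans h2 _; rewrite ler_pM2l.
  rewrite mulrA (_ : C * (1 / (2 * C)) = 1 / 2); last by field; rewrite gt_eqF.
  by move: xa0; clear; lra.
exists (r / 2); first by rewrite divr_gt0.
split=> [rho /andP[rho0 rhor]|x xa]; last first.
  by have := @convex_ne0 1 x; rewrite ler01 lexx subrr scale0r add0r scale1r => /(_ isT xa).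
apply: has_local_degree_homotopy (lin_degree_unit dA a rho0) => //.
  exact: lin_at_continuous.
move=> t x t01 /= /andP[xa1 xa2]; apply: convex_ne0 => //.
by rewrite (lt_le_trans _ xa1) ?divr_gt0 //= (le_trans xa2).
Qed.

(** Excision for weights: the region [P] and the sub-box may differ, but only in cells of weight
    zero. This permits summing over a ball around a zero while the degree is computed on a box. *)
Lemma sum_subbox n N M (lo : gridpt n) (w : gridpt n -> int) (P : pred (gridpt n)) :
  (0 < N)%N -> (0 < M)%N -> (forall i, lo i + M <= N)%N ->
  (forall x, P x -> w x != 0 -> forall i, (lo i <= x i < lo i + M)%N) ->
  (forall y : gridpt n, (forall i, y i < M)%N ->
     ~~ P (fun i => lo i + y i)%N -> w (fun i => lo i + y i)%N = 0) ->
  \sum_(x : {ffun 'I_n -> 'I_N} | P (natpt x)) w (natpt x) =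
  \sum_(y : {ffun 'I_n -> 'I_M}) w (fun i => lo i + y i)%N.
Proof.
case: N => // N _; case: M => // M _ loM inbox outP.
pose up (y : {ffun 'I_n -> 'I_M.+1}) : {ffun 'I_n -> 'I_N.+1} :=
  [ffun i => inord (lo i + y i)].
pose down (x : {ffun 'I_n -> 'I_N.+1}) : {ffun 'I_n -> 'I_M.+1} :=
  [ffun i => inord (x i - lo i)].
have upE y : natpt (up y) = (fun i => lo i + y i)%N.
  apply/funext => i; rewrite /natpt ffunE inordK //.
  by rewrite (leq_trans _ (loM i)) // ltn_add2l.
have downK y : down (up y) = y.
  apply/ffunP => i; rewrite ffunE; apply/val_inj => /=.
  by rewrite -[nat_of_ord (up y i)]/(natpt (up y) i) upE addKn inordK.
rewrite (bigID (fun x : {ffun 'I_n -> 'I_N.+1} => w (natpt x) != 0)) /= addrC big1 ?add0r; last first.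
  by move=> x /andP[_]; rewrite negbK => /eqP.
rewrite (reindex_onto up down) /=; last first.
  move=> x /andP[Px wx]; apply/ffunP => i; apply/val_inj.
  rewrite -[val _]/(natpt (up (down x)) i) upE ffunE.
  have /andP[h1 h2] := inbox _ Px wx i.
  have h3 : (x i - lo i < M.+1)%N by rewrite ltn_subLR // [(_ + M)%N]addnC.
  by rewrite inordK // subnKC.
rewrite [RHS](bigID (fun y : {ffun 'I_n -> 'I_M.+1} =>
  P (natpt (up y)) && (w (natpt (up y)) != 0))) /=.
rewrite [X in _ = _ + X]big1 ?addr0; last first.
  move=> y; rewrite upE negb_and negbK => /orP[nP|/eqP //].
  by apply: outP => // i.
apply: eq_big => [y|y _]; first by rewrite downK eqxx andbT.
by rewrite upE.
Qed.

Lemma common_radius (R : realType) (T : eqType) (s : seq T) (P : T -> R -> Prop) :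
  (forall a r r', 0 < r' <= r -> P a r -> P a r') ->
  (forall a, a \in s -> exists2 r, 0 < r & P a r) ->
  exists2 r, 0 < r & forall a, a \in s -> P a r.
Proof.
move=> mono; elim: s => [_|a s IH H]; first by exists 1.
have [r1 r10 P1] := H a (mem_head _ _).
have [|r2 r20 P2] := IH; first by move=> b bs; apply: H; rewrite inE bs orbT.
have m0 : 0 < Num.min r1 r2 by rewrite lt_min r10.
exists (Num.min r1 r2) => // b; rewrite inE => /predU1P[->|bs].
  by apply: mono P1; rewrite m0 ge_min lexx.
by apply: mono (P2 b bs); rewrite m0 ge_min lexx orbT.
Qed.

(** Isolation is required at every point of [K], zero or not: the punctured balls then give a cover,
    and each ball of a finite subcover contains no zero other than its centre. *)
Lemma compact_finite_zeros (R : realType) n (K : set 'rV[R]_n) (G : 'rV[R]_n -> 'rV[R]_n) :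
  compact K ->
  (forall a, K a -> exists2 rho, 0 < rho & forall x, 0 < `|x - a| < rho -> G x != 0) ->
  finite_set (K `&` G @^-1` [set 0]).
Proof.
rewrite compact_cover => cK iso.
have /choice[rho Hrho] a : exists rho, K a ->
    0 < rho /\ forall x, 0 < `|x - a| < rho -> G x != 0.
  by have [/iso[rho r0 H]|nK] := pselect (K a); [exists rho | exists 0].
have [||D' D'K HD'] := cK _ K (fun a => ball a (rho a)).
- by move=> a /Hrho[r0 _]; exact: ball_open.
- by move=> a Ka; exists a => //; apply: ballxx; case: (Hrho a Ka).
apply: sub_finite_set (finite_fset D') => x [Kx Gx].
have [a aD] := HD' x Kx; rewrite -ball_normE /= distrC => xa.
have [<- //|ne] := eqVneq a x.
have [|_ /(_ x)] := Hrho a; first by have := D'K a aD; rewrite inE.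
by rewrite xa normr_gt0 subr_eq0 eq_sym ne Gx eqxx => /(_ isT).
Qed.

Section Excision.
Variables (R : realType) (n : nat).

Definition cube_degree (r : R) N (G : 'rV[R]_n -> 'rV[R]_n) : int :=
  grid_degree (const_mx (- r)) (2 * r / N%:R) N G.

Lemma closed_cube (r : R) : closed [set x : 'rV[R]_n | `|x| <= r].
Proof.
have -> : [set x : 'rV[R]_n | `|x| <= r] = Num.norm @^-1` [set t | t <= r]%classic by [].
apply: preimage_closed; last exact: closed_le.
by move=> x _; exact: norm_continuous.
Qed.

Lemma compact_closed_cube (r : R) : compact [set x : 'rV[R]_n | `|x| <= r].
Proof.
apply: bounded_closed_compact (@closed_cube r).
exists r; split; first exact: num_real.
by move=> M rM x /= xr; apply: le_trans xr (ltW rM).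
Qed.

Lemma grid_in_cube (r : R) N x : 0 < r -> (0 < N)%N -> (forall i, x i <= N)%N ->
  `|gpos (const_mx (- r) : 'rV[R]_n) (2 * r / N%:R) x| <= r.
Proof.
move=> r0 N0 xN; apply: row_norm_le; first exact: ltW.
move=> i; rewrite !mxE ler_norml.
have N0' : 0 < (N%:R : R) by rewrite ltr0n.
have X0 : 0 <= 2 * r / N%:R * (x i)%:R by rewrite mulr_ge0 // divr_ge0 // mulr_ge0 // ltW.
have X2 : 2 * r / N%:R * (x i)%:R <= 2 * r.
  by rewrite -mulrA ler_piMr ?mulr_ge0 ?(ltW r0) // mulrC ler_pdivrMr // mul1r ler_nat.
by move: X0 X2; clear; lra.
Qed.

End Excision.

Lemma isolated_zero (R : realType) n (G : 'rV[R]_n.+1 -> 'rV[R]_n.+1) a :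
  continuous G -> differentiable G a -> (G a = 0 -> \det ('J G a) != 0) ->
  exists2 rho, 0 < rho & forall x, 0 < `|x - a| < rho -> G x != 0.
Proof.
move=> cG dG reg; have [Ga0|Ga0] := eqVneq (G a) 0.
  have [rho rho0 [_ H]] := regular_zero cG dG Ga0 (reg Ga0).
  by exists rho => // x /andP[x0 /ltW xr]; apply: H; rewrite x0.
have Gp : 0 < `|G a| by rewrite normr_gt0.
have /cvgrPdist_lt/(_ _ Gp) := cG a; move=> /nbhs_ballP[/= e e0 He].
exists e => // x /andP[_ xa]; apply/eqP => Gx0.
by have := He x; rewrite /= -ball_normE /= distrC Gx0 subr0 ltxx => /(_ xa).
Qed.

Section RegularDegree.
Variables (R : realType) (n : nat).
Implicit Types (r : R) (G : 'rV[R]_n.+1 -> 'rV[R]_n.+1).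

Definition regular_on_cube r G :=
  [/\ 0 < r, continuous G, forall x, differentiable G x,
      forall x, `|x| = r -> G x != 0 &
      forall x, `|x| < r -> G x = 0 -> \det ('J G x) != 0].

Lemma zero_interior r G x : regular_on_cube r G -> `|x| <= r -> G x = 0 -> `|x| < r.
Proof.
case=> _ _ _ bdG _ xr Gx; rewrite lt_neqAle xr andbT; apply/eqP => /bdG.
by rewrite Gx eqxx.
Qed.

Lemma regular_zeros_fset r G : regular_on_cube r G -> exists s : seq 'rV[R]_n.+1,
  [/\ uniq s, forall a, (a \in s) = (`|a| < r) && (G a == 0) &
   regular_degree G [set x | `|x| < r] 0 = \sum_(a <- s) sgz (\det ('J G a))].
Proof.
move=> rG; have [r0 cG dG bdG regG] := rG.
have fin : finite_set ([set x : 'rV[R]_n.+1 | `|x| < r] `&` G @^-1` [set 0]).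
  apply: (@sub_finite_set _ _ ([set x : 'rV[R]_n.+1 | `|x| <= r] `&` G @^-1` [set 0])).
    by move=> x [/= xr Gx]; split=> //=; exact: ltW.
  apply: compact_finite_zeros; first exact: compact_closed_cube.
  move=> a aK; apply: isolated_zero => // Ga0; apply: regG => //.
  exact: (zero_interior rG).
exists (finmap.enum_fset (fset_set ([set x | `|x| < r] `&` G @^-1` [set 0]))).
split; [exact: finmap.fset_uniq | | by rewrite /regular_degree fsbig_finite].
move=> a; transitivity (a \in [set x : 'rV[R]_n.+1 | `|x| < r] `&` G @^-1` [set 0]).
  exact: in_fset_set fin a.
apply/idP/idP; first by rewrite inE => -[/= -> /= ->]; rewrite eqxx.
by rewrite inE => /andP[ar /eqP Ga]; split.
Qed.

Lemma zeros_separated r G (s : seq 'rV[R]_n.+1) : regular_on_cube r G ->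
  (forall a, (a \in s) = (`|a| < r) && (G a == 0)) ->
  exists2 rho, 0 < rho & forall a, a \in s ->
    [/\ has_local_degree a G rho (sgz (\det ('J G a))),
        forall b, b \in s -> b != a -> 2 * rho < `|b - a| & `|a| + rho < r].
Proof.
move=> [r0 cG dG bdG regG] sE.
(* The local degree is asked for at all smaller radii, since [common_radius] needs a property that
   survives shrinking. *)
pose P a rho := [/\ forall rho', 0 < rho' <= rho ->
   has_local_degree a G rho' (sgz (\det ('J G a))),
   forall b, b \in s -> b != a -> 2 * rho < `|b - a| & `|a| + rho < r].
have [||rho rho0 H] := @common_radius R _ s P; last first.
- by exists rho => // a /H[H1 H2 H3]; split=> //; apply: H1; rewrite rho0 lexx.
- move=> a; rewrite sE => /andP[ar /eqP Ga].
  have [t t0 [H1 H2]] := regular_zero cG (dG a) Ga (regG _ ar Ga).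
  have ra : 0 < r - `|a| by rewrite subr_gt0.
  (* The ball of radius t contains no second zero, and twice t / 3 is still below t; half the
     distance to the sphere keeps the last inequality strict. *)
  exists (Num.min (t / 3) ((r - `|a|) / 2)); first by rewrite lt_min !divr_gt0.
  have m1 : Num.min (t / 3) ((r - `|a|) / 2) <= t / 3 by rewrite ge_min lexx.
  have m2 : Num.min (t / 3) ((r - `|a|) / 2) <= (r - `|a|) / 2 by rewrite ge_min lexx orbT.
  move: (Num.min _ _) m1 m2 => m m1 m2; split.
  + move=> rho' /andP[r'0 r'm]; apply: H1; rewrite r'0 /=.
    by move: t0 m1 r'm; clear; lra.
  + move=> b; rewrite sE => /andP[_ /eqP Gb] ba; rewrite ltNge; apply/negP => le.
    have := H2 b; rewrite normr_gt0 subr_eq0 ba Gb eqxx /= => H3.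
    have /H3 // : `|b - a| <= t by move: t0 m1 le; clear; lra.
  + by move: ra m2; clear; lra.
- move=> a t t' /andP[t'0 t't] [H1 H2 H3]; split.
  + by move=> rho' /andP[p0 pt]; apply: H1; rewrite p0 (le_trans pt).
  + by move=> b bs ba; apply: le_lt_trans (H2 b bs ba); rewrite ler_pM2l.
  + by apply: le_lt_trans H3; rewrite lerD2l.
Qed.

Lemma small_near_zero r G (s : seq 'rV[R]_n.+1) (e : R) :
  regular_on_cube r G ->
  (forall a, (a \in s) = (`|a| < r) && (G a == 0)) -> 0 < e ->
  exists2 m, 0 < m & forall x, `|x| <= r -> `|G x| < m ->
    exists2 a, a \in s & `|x - a| < e.
Proof.
move=> rG sE e0; have [r0 cG dG bdG regG] := rG.
pose K' := [set x : 'rV[R]_n.+1 | `|x| <= r] `&` \bigcap_(a in [set` s]) (fun x => `|x - a|) @^-1` [set t | e <= t].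
have cK' : compact K'.
  apply: (subclosed_compact _ (@compact_closed_cube R n.+1 r)); last by move=> x [].
  apply: closedI; first exact: closed_cube.
  apply: closed_bigI => a _; apply: preimage_closed; last exact: closed_ge.
  by move=> x _; exact: norm_continuous_sub.
have [||m m0 Hm] := @compact_pos_lb R _ K' (fun x => `|G x|) cK'.
- by move=> x; exact: cvg_norm (cG x).
- move=> x [xK xs]; rewrite normr_gt0; apply/eqP => Gx.
  have xin : x \in s by rewrite sE Gx eqxx andbT (zero_interior rG).
  by have := xs x xin; rewrite /= subrr normr0 leNgt e0.
exists m => // x xr Gxm; apply: contrapT => H.
move: Gxm; rewrite ltNge => /negP; apply; apply: Hm; split=> // a /= ain.
by rewrite leNgt; apply/negP => lt; apply: H; exists a.
Qed.

End RegularDegree.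

(** * The grid degree is the signed count of zeros *)

Section CubeDegree.
Variables (R : realType) (n : nat).
Implicit Types (b a : 'rV[R]_n.+1) (h r rho : R) (G : 'rV[R]_n.+1 -> 'rV[R]_n.+1).

Definition cell_weight b h G (x : gridpt n.+1) : int :=
  cupseq (grid_signs b h G) (enum 'I_n.+1) (@cochain1 n.+1) x [set: 'I_n.+1]%SET.

Lemma cell_weight_shift b h G lo y :
  cell_weight b h G (fun i => lo i + y i)%N = cell_weight (gpos b h lo) h G y.
Proof.
rewrite /cell_weight -cupseq_shift; congr cupseq.
apply/funext => k; apply/funext => z; rewrite /grid_signs /signs.
rewrite (_ : gpos b h (fun i => (lo i + z i)%N) = gpos (gpos b h lo) h z) //.
by apply/rowP => i; rewrite !mxE natrD mulrDr addrA.
Qed.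

(** The box around [a] consists of cells of the large grid, with faces at distance about 3/4 rho
    from [a]. Rounding shifts a face by at most 2 h < rho / 8, so all faces stay in the annulus, and
    the box contains the ball of radius rho / 4. *)
Lemma local_sum r N h G a rho deg (w := cell_weight (const_mx (- r)) h G) :
  0 < h -> h < rho / 16 -> (0 < N)%N -> h * N%:R = 2 * r -> `|a| + rho < r ->
  (forall b' M, (forall x, box_bdry M x -> annulus a rho (gpos b' h x)) ->
     (forall i, b' 0 i < a 0 i < b' 0 i + h * M%:R) -> grid_degree b' h M G = deg) ->
  (forall x, (forall i, (x i < N)%N) -> `|gpos (const_mx (- r)) h x - a| <= rho ->
     w x != 0 -> `|gpos (const_mx (- r)) h x - a| < rho / 4) ->
  \sum_(x : {ffun 'I_n.+1 -> 'I_N} | `|gpos (const_mx (- r)) h (natpt x) - a| < rho / 4)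
    w (natpt x) = deg.
Proof.
move=> h0 hrho N0 hN ar Hdeg Hnear.
have rho0 : 0 < rho by move: h0 hrho; clear; lra.
(* Offset of the ideal lower face, [a 0 i - 3 / 4 * rho], from the face -r of the cube; [lo] and [M]
   round this offset and the ideal side 3/2 rho down to the grid. *)
pose q i := a 0 i - 3 / 4 * rho + r.
have ai i : `|a 0 i| <= r - rho.
  by apply: le_trans (coord_le_norm a i) _; rewrite lerBrDr ltW.
have q0 i : 0 <= q i by have := ai i; rewrite ler_norml /q; move: rho0; clear; lra.
pose lo i := Num.truncn (q i / h).
pose M := Num.truncn (3 / 2 * rho / h).
have loE i : h * (lo i)%:R <= q i < h * (lo i)%:R + h.
  have /truncn_itv/andP[l1 l2] : 0 <= q i / h by rewrite divr_ge0 // ltW.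
  move: l1 l2; rewrite -/(lo i) ler_pdivlMr // ltr_pdivrMr // -natr1.
  by clear; lra.
have ME : h * M%:R <= 3 / 2 * rho < h * M%:R + h.
  have /truncn_itv/andP[l1 l2] : 0 <= 3 / 2 * rho / h.
    by apply: divr_ge0; [apply: mulr_ge0; [apply: divr_ge0|exact: ltW]|exact: ltW].
  move: l1 l2; rewrite -/M ler_pdivlMr // ltr_pdivrMr // -natr1.
  by clear; lra.
have M0 : (0 < M)%N.
  rewrite lt0n; apply/eqP => M0; move: ME; rewrite M0 mulr0.
  by move: h0 hrho; clear; lra.
have loMN i : (lo i + M <= N)%N.
  rewrite -(ler_nat R) natrD -(ler_pM2l h0) mulrDr hN.
  move: (loE i) ME (ai i); rewrite /q ler_norml.
  by move: rho0; clear; lra.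
have coordE x i : (gpos (const_mx (- r)) h x - a) 0 i = - r + h * (x i)%:R - a 0 i.
  by rewrite !mxE.
have inbox y i : (y i <= M)%N -> - rho <= - r + h * (lo i + y i)%:R - a 0 i <= rho.
  move=> yM; have hy : h * (y i)%:R <= h * M%:R by rewrite ler_pM2l // ler_nat.
  have hy0 : 0 <= h * (y i)%:R by rewrite mulr_ge0 // ltW.
  rewrite natrD mulrDr; move: (loE i) ME hy hy0; rewrite /q.
  by move: rho0 hrho; clear; lra.
have inball y : (forall i, (y i <= M)%N) ->
    `|gpos (const_mx (- r)) h (fun i => lo i + y i)%N - a| <= rho.
  move=> yM; apply: row_norm_le => [|i]; first exact: ltW.
  by rewrite coordE ler_norml inbox.
rewrite (@sum_subbox n.+1 N M lo w
  (fun x => `|gpos (const_mx (- r)) h x - a| < rho / 4)) //; last 2 first.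
- move=> x xa _ i; have := le_lt_trans (coord_le_norm _ i) xa.
  rewrite coordE ltr_norml => xi.
  rewrite -(ler_nat R) -(ltr_nat R) natrD -(ler_pM2l h0) -(ltr_pM2l h0) mulrDr.
  move: (loE i) ME xi; rewrite /q.
  by move: rho0 hrho; clear; lra.
- move=> y yM /negP nP; apply/eqP; apply: contraT => wy; case: nP.
  apply: Hnear => //; last by apply: inball => i; exact: ltnW.
  by move=> i; apply: leq_trans (loMN i); rewrite ltn_add2l.
rewrite (eq_bigr (fun y : {ffun 'I_n.+1 -> 'I_M} =>
  cell_weight (gpos (const_mx (- r)) h lo) h G (natpt y))); last first.
  by move=> y _; rewrite -cell_weight_shift.
rewrite -/(gdegree _ _) -/(grid_degree _ _ _ _); apply: Hdeg.
  move=> y [yM [i yi]] /=.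
  have -> : gpos (gpos (const_mx (- r)) h lo) h y = gpos (const_mx (- r)) h (fun i => lo i + y i)%N.
    by apply/rowP => j; rewrite !mxE natrD mulrDr addrA.
  apply/andP; split; last exact: inball.
  apply: le_trans (coord_le_norm _ i).
  rewrite coordE natrD mulrDr; case: yi => ->.
    rewrite ler_normr; apply/orP; right; rewrite mulr0 addr0.
    by move: (loE i); rewrite /q; move: rho0 hrho; clear; lra.
  rewrite ler_normr; apply/orP; left.
  by move: (loE i) ME; rewrite /q; move: rho0 hrho; clear; lra.
move=> i; rewrite !mxE; move: (loE i) ME; rewrite /q.
by move: rho0 hrho; clear; lra.
Qed.

Lemma cube_degree_regular r G : regular_on_cube r G ->
  exists2 h0, 0 < h0 & forall N, (0 < N)%N -> 2 * r / N%:R < h0 ->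
    cube_degree r N G = regular_degree G [set x | `|x| < r] 0.
Proof.
move=> rG; have [s [us sE ->]] := regular_zeros_fset rG.
have [rho rho0 Hs] := zeros_separated rG sE.
have [r0 cG _ _ _] := rG.
have rho40 : 0 < rho / 4 by rewrite divr_gt0.
have [m m0 Hm] := small_near_zero rG sE rho40.
have m20 : 0 < m / 2 by rewrite divr_gt0.
have [d d0 Hd] := compact_unif_cont (@compact_closed_cube R n.+1 r) cG m20.
pose P a h0 := forall h b M, 0 < h < h0 ->
    (forall x, box_bdry M x -> annulus a rho (gpos b h x)) ->
    (forall i, b 0 i < a 0 i < b 0 i + h * M%:R) ->
    grid_degree b h M G = sgz (\det ('J G a)).
have [||h1 h10 H1] := @common_radius R _ s P.
- move=> a t t' /andP[t'0 t't] Pa h b M /andP[h0 ht]; apply: Pa.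
  by rewrite h0 (lt_le_trans ht).
- by move=> a /Hs[[t t0 Ht] _ _]; exists t.
have rho160 : 0 < rho / 16 by rewrite divr_gt0.
exists (Num.min (Num.min d h1) (rho / 16)); first by rewrite !lt_min d0 h10.
move=> N N0; rewrite !lt_min => /andP[/andP[hd hh1] hrho].
have N0' : 0 < (N%:R : R) by rewrite ltr0n.
have hN : 2 * r / N%:R * N%:R = 2 * r by rewrite divfK // gt_eqF.
have h0 : 0 < 2 * r / N%:R by rewrite divr_gt0 // mulr_gt0.
set h := 2 * r / N%:R in hd hh1 hrho hN h0 *.
pose w := cell_weight (const_mx (- r)) h G.
have near_zero x : (forall i, (x i < N)%N) -> w x != 0 ->
    exists2 a, a \in s & `|gpos (const_mx (- r)) h x - a| < rho / 4.
  move=> xN wx; apply: Hm; first by apply: grid_in_cube => // i; exact: ltnW.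
  apply: (@le_lt_trans _ _ (m / 2)); last by rewrite ltr_pdivrMr // ltr_pMr // ltr1n.
  apply: (@grid_support R n.+1 _ _ _ x) wx; first exact: ltW.
  move=> y xy; apply/ltW/Hd; first by apply: grid_in_cube => // i; exact: ltnW.
  apply: le_lt_trans hd; apply: gpos_adjacent; first exact: ltW.
  by exists x; split=> //; exact: in_cell_refl.
have unique_zero x a a' : a \in s -> a' \in s ->
    `|x - a| <= rho -> `|x - a'| < rho / 4 -> a' = a.
  move=> /Hs[_ sep _] a's xa xa'; apply/eqP; apply: contraT => ne.
  have := sep a' a's ne; rewrite (_ : a' - a = (x - a) - (x - a')); last first.
    by rewrite opprB [RHS]addrC addrA subrK.
  have := ler_normB (x - a) (x - a').
  by move: rho0 xa xa'; clear; lra.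
rewrite /cube_degree /grid_degree /gdegree -/h -/w.
(* Every cell of non-zero weight is within rho / 4 of exactly one zero, so its weight can be charged
   to that zero and the sums exchanged. *)
rewrite (eq_bigr (fun x : {ffun 'I_n.+1 -> 'I_N} =>
  \sum_(a <- s) if `|gpos (const_mx (- r)) h (natpt x) - a| < rho / 4 then w (natpt x) else 0)).
  rewrite exchange_big /=; apply: eq_big_seq => a as_; rewrite -big_mkcond /=.
  have [_ _ ar] := Hs a as_.
  apply: local_sum => //.
    by move=> b' M H2 H3; apply: H1 => //; rewrite h0.
  move=> x xN xa wx; have [a' a's xa'] := near_zero x xN wx.
  by rewrite -(unique_zero _ a a' as_ a's xa xa').
move=> x _; have [wx0|wx0] := eqVneq (w (natpt x)) 0.
  rewrite -/(cell_weight _ _ _ _) -/(w _) wx0 big1 // => a _; by case: ifP.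
have [|a as_ xa] := near_zero (natpt x) _ wx0; first by move=> i; exact: ltn_ord.
rewrite (bigD1_seq a) //= xa big1_seq ?addr0 // => a' /andP[ne a's].
case: ifP => // xa'; case/eqP: ne; apply: unique_zero xa' => //.
apply: le_trans (ltW xa) _; by rewrite ler_pdivrMr // ler_pMr // ler1n.
Qed.

End CubeDegree.

Lemma eventually_mesh_lt (R : realType) (c e : R) : 0 <= c -> 0 < e ->
  exists2 N0 : nat, (0 < N0)%N & forall N, (N0 <= N)%N -> c / N%:R < e.
Proof.
move=> c0 e0; exists (Num.truncn (c / e)).+1 => // N N0.
have N0' : 0 < (N%:R : R) by rewrite ltr0n (leq_trans _ N0).
rewrite ltr_pdivrMr // mulrC -ltr_pdivrMr //.
by apply: lt_le_trans (truncnS_gt _) _; rewrite ler_nat.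
Qed.

(** * Grid degree and Brouwer degree on a cube *)

Section BrouwerCube.
Variables (R : realType) (n : nat).
Implicit Types (r : R) (F G H : 'rV[R]_n -> 'rV[R]_n).

Local Notation cube r := [set x : 'rV[R]_n | `|x| < r].

Lemma compact_sphere r : compact [set x : 'rV[R]_n | `|x| = r].
Proof.
apply: (subclosed_compact _ (@compact_closed_cube R n r)); last by move=> x /= ->.
have -> : [set x : 'rV[R]_n | `|x| = r] = Num.norm @^-1` [set t | t = r]%classic by [].
by apply: preimage_closed; [move=> x _; exact: norm_continuous | exact: closed_eq].
Qed.

Lemma grid_bdry_sphere r N x : 0 < r -> (0 < N)%N -> box_bdry N x ->
  `|gpos (const_mx (- r) : 'rV[R]_n) (2 * r / N%:R) x| = r.
Proof.
move=> r0 N0 [xN [i xi]]; apply/eqP; rewrite eq_le grid_in_cube //=.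
apply: le_trans (coord_le_norm _ i); rewrite !mxE.
case: xi => ->; first by rewrite mulr0 addr0 normrN ler_norm.
rewrite divfK ?pnatr_eq0 -?lt0n //; rewrite (_ : - r + 2 * r = r) ?ler_norm //; ring.
Qed.

Lemma cube_degree_homotopy r H0 H1 : 0 < r -> continuous H0 -> continuous H1 ->
  (forall t x, 0 <= t <= 1 -> `|x| = r -> (1 - t) *: H0 x + t *: H1 x != 0) ->
  exists2 N0, (0 < N0)%N & forall N, (N0 <= N)%N ->
    cube_degree r N H0 = cube_degree r N H1.
Proof.
move=> r0 c0 c1 ne0; have r20 : 0 < 2 * r by rewrite mulr_gt0.
have [h0 h00 Hh] := grid_degree_homotopy (@compact_sphere r) c0 c1 ne0.
have [N0 N00 HN] := eventually_mesh_lt (ltW r20) h00.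
exists N0 => // N leN; have N0' := leq_trans N00 leN.
apply: Hh => [|x xb]; last exact: grid_bdry_sphere.
by rewrite HN // andbT divr_gt0 // ltr0n.
Qed.

Lemma cube_degree_nonvanishing r F : 0 < r -> continuous F -> (0 < n)%N ->
  (forall x, `|x| <= r -> F x != 0) ->
  exists2 N0, (0 < N0)%N & forall N, (N0 <= N)%N -> cube_degree r N F = 0.
Proof.
move=> r0 cF n0 ne0.
have [||m m0 Hm] := @compact_pos_lb R _ _ (fun x => `|F x|) (@compact_closed_cube R n r).
- by move=> x; exact: cvg_norm (cF x).
- by move=> x xr; rewrite normr_gt0 ne0.
have m20 : 0 < m / 2 by rewrite divr_gt0.
have [d d0 Hd] := compact_unif_cont (@compact_closed_cube R n r) cF m20.
have r20 : 0 < 2 * r by rewrite mulr_gt0.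
have [N0 N00 HN] := eventually_mesh_lt (ltW r20) d0.
exists N0 => // N leN; have N0' := leq_trans N00 leN.
rewrite /cube_degree /grid_degree /gdegree big1 // => x _.
have xN i : (natpt x i <= N)%N by rewrite ltnW // ltn_ord.
apply/eqP; apply: contraT => /(@grid_support R n _ _ _ (natpt x) _ (ltW m20)) H.
have xr := grid_in_cube r0 N0' xN.
suff /H : forall y, in_cell (natpt x) [set: 'I_n]%SET y ->
    `|F (gpos (const_mx (- r)) (2 * r / N%:R) (natpt x)) -
      F (gpos (const_mx (- r)) (2 * r / N%:R) y)| <= m / 2.
  by move=> h; have := le_trans (Hm _ xr) h; move: m0; clear; lra.
move=> y xy; apply/ltW/Hd => //; apply: le_lt_trans (HN _ leN).
apply: gpos_adjacent; first by rewrite divr_ge0 // ltW.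
by exists (natpt x); split=> //; exact: in_cell_refl.
Qed.

Lemma closure_cube r : closure (cube r) `<=` [set x | `|x| <= r].
Proof.
rewrite [X in _ `<=` X](closure_id _).1; last exact: closed_cube.
by apply: closureS => x /= /ltW.
Qed.

Lemma sphere_sub_bdry r x : 0 < r -> `|x| = r -> bdry (cube r) x.
Proof.
move=> r0 xr; split; last by rewrite /= xr ltxx.
move=> U /nbhs_ballP[e /= e0 He].
pose t := Num.min (1 / 2) (e / (2 * r)).
have t0 : 0 < t by rewrite lt_min !divr_gt0 // mulr_gt0.
have t1 : t <= 1 / 2 by rewrite ge_min lexx.
have te : t <= e / (2 * r) by rewrite ge_min lexx orbT.
exists ((1 - t) *: x); split => /=.
  rewrite normrZ xr ger0_norm; last by move: t1; clear; lra.
  by rewrite gtr_pMl //; move: t0; clear; lra.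
apply: He; rewrite -ball_normE /= scalerBl scale1r opprB addrC subrK.
rewrite normrZ xr gtr0_norm //.
have : t * r <= e / 2.
  by move: te; rewrite ler_pdivlMr ?mulr_gt0 //; clear; lra.
by move: e0; clear; lra.
Qed.

Lemma bdry_sub_sphere r x : bdry (cube r) x -> `|x| = r.
Proof.
move=> [/closure_cube/= xr /negP]; rewrite /= -leNgt => rx.
by apply/eqP; rewrite eq_le xr.
Qed.

End BrouwerCube.

(** Every regular approximation yields the count v, hence so does the one selected by [xget]. If
    there were none, [xget] would return its default 0; this is the reason for the disjunction. *)
Lemma brouwer_degree_cube (R : realType) n (F : 'rV[R]_n -> 'rV[R]_n) r v N0
    (D := [set x : 'rV[R]_n | `|x| < r]) :
  (0 < n)%N -> 0 < r -> continuous F ->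
  (forall N, (N0 <= N)%N -> cube_degree r N F = v) ->
  v = 0 \/ (exists G, regular_approx F D 0 G) ->
  brouwer_degree F D 0 = v.
Proof.
case: n F @D => // n F D _ r0 cF Fv ex.
have H G : regular_approx F D 0 G -> regular_degree G D 0 = v.
  move=> [[dG _] regG [e le_e lt_e]].
  have cG : continuous G by move=> x; apply: differentiable_continuous.
  (* On the sphere [F] has norm at least [e] and [G - F] less than [e], so the segment from [F] to
     [G] avoids 0. *)
  have ne0 t x : 0 <= t <= 1 -> `|x| = r -> (1 - t) *: F x + t *: G x != 0.
    move=> /andP[t0 t1] xr; have xb := sphere_sub_bdry r0 xr.
    have h1 := le_e x xb; have h2 := lt_e x xb.1.
    rewrite subr0 in h1; apply/eqP => e0.
    have : F x = - (t *: (G x - F x)).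
      apply/eqP; rewrite -addr_eq0 -e0 scalerBr scalerBl scale1r addrA.
      by rewrite addrAC.
    move=> /(congr1 Num.norm); rewrite normrN normrZ ger0_norm // => h3.
    have : t * `|G x - F x| <= `|G x - F x| by rewrite ler_piMl.
    by move: h1 h2; rewrite h3; clear; lra.
  have rG : regular_on_cube r G.
    split=> // x xr.
    by have := ne0 1 x; rewrite ler01 lexx subrr scale0r add0r scale1r => /(_ isT xr).
  have [h0 h00 Hh] := cube_degree_regular rG.
  have [N1 N10 HN1] := cube_degree_homotopy r0 cF cG ne0.
  have [|N2 N20 HN2] := @eventually_mesh_lt R (2 * r) h0 _ h00.
    by rewrite mulr_ge0 // ltW.
  pose N := maxn N0 (maxn N1 N2).
  rewrite -(Fv N) ?leq_maxl // HN1 ?Hh // /N.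
  - by rewrite !leq_max N10 !orbT.
  - by apply: HN2; rewrite !leq_max leqnn !orbT.
  - by rewrite !leq_max leqnn !orbT.
rewrite /brouwer_degree; case: xgetP => [d _ [G /H <- ->] //|none].
case: ex => [-> //|[G rG]]; case: (none (regular_degree G D 0)).
by exists G.
Qed.

(** * A Sard lemma by counting *)

Section Sard.
Variables (R : realType) (n : nat).
Implicit Types (u v x y : 'rV[R]_n.+1).

Definition dotr u v : R := \sum_i u 0 i * v 0 i.

(** [v] annihilates the range of J. Singling out its largest coordinate [i0] turns a bound on [dotr]
    into one on coordinate [i0] whose constant does not depend on [v]. *)
Lemma singular_functional (J : 'M[R]_n.+1) : \det J = 0 ->
  exists v i0, [/\ v 0 i0 != 0, forall i, `|v 0 i| <= `|v 0 i0| &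
                   forall u, dotr (u *m J) v = 0].
Proof.
move=> dJ; have /det0P[v v0 vJ] : \det J^T == 0 by rewrite det_tr dJ.
pose i0 := [arg max_(i > (ord0 : 'I_n.+1)) `|v 0 i|]%O.
have Hi0 i : `|v 0 i| <= `|v 0 i0|.
  by rewrite /i0; case: arg_maxP => // j _; exact.
exists v, i0; split=> // [|u].
  apply: contraNneq v0 => v00; apply/eqP/rowP => i; rewrite mxE; apply/eqP.
  by rewrite -normr_le0; have := Hi0 i; rewrite v00 normr0.
have : (u *m J *m v^T) 0 0 = 0.
  have -> : u *m J *m v^T = u *m (v *m J^T)^T by rewrite trmx_mul trmxK mulmxA.
  by rewrite vJ trmx0 mulmx0 mxE.
by rewrite mxE => <-; apply: eq_bigr => i _; rewrite [v^T _ _]mxE.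
Qed.

Lemma dotr_le u v (c d : R) : 0 <= c -> `|u| <= c -> (forall i, `|v 0 i| <= d) ->
  `|dotr u v| <= n.+1%:R * c * d.
Proof.
move=> c0 uc vd; apply: le_trans (ler_norm_sum _ _ _) _.
apply: (@le_trans _ _ (\sum_(i < n.+1) c * d)).
  apply: ler_sum => i _; rewrite normrM; apply: ler_pM => //.
  exact: le_trans (coord_le_norm u i) uc.
by rewrite sumr_const card_ord -mulrA mulr_natl.
Qed.

Lemma dotrB u u' v : dotr (u - u') v = dotr u v - dotr u' v.
Proof. by rewrite /dotr -sumrB; apply: eq_bigr => i _; rewrite !mxE mulrBl. Qed.

(** A lattice point in a window shorter than m steps is determined by its residue, so possible
    values can be counted without locating the window. *)
Lemma eqmod_close (a b m : nat) (s c : R) : 0 < s -> c < s * m%:R ->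
  `|s * a%:R - s * b%:R| <= c -> a = b %[mod m] -> a = b.
Proof.
move=> s0; wlog ab : a b / (b <= a)%N.
  move=> H cm abc e; have [ba|/ltnW ab] := leqP b a; first exact: H.
  by apply/esym; apply: H => //; rewrite distrC.
move=> cm; rewrite -mulrBr -natrB // normrM gtr0_norm // normr_nat => le.
have ltm : (a - b < m)%N by rewrite -(ltr_nat R) -(ltr_pM2l s0) (le_lt_trans le).
move/eqP; rewrite eqn_mod_dvd // => /dvdnP[q qe]; move: ltm; rewrite qe.
case: q qe => [|q] qe; last by rewrite mulSn ltnNge leq_addr.
by move: qe; rewrite mul0n => /eqP; rewrite subn_eq0 => ab' _; apply/eqP; rewrite eqn_leq ab'.
Qed.

Definition quadratic_remainder (r d0 C L : R) (G : 'rV[R]_n.+1 -> 'rV[R]_n.+1)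
    (J : 'rV[R]_n.+1 -> 'M[R]_n.+1) :=
  forall x y, `|x| <= r -> `|y| <= r -> `|y - x| <= d0 ->
   `|G y - G x - (y - x) *m J x| <= C * `|y - x| ^+ 2 /\
   `|G y - G x| <= L * `|y - x|.

(* Values of critical points of one cell lie in a slab of width O(l^2). *)
Lemma critical_values_cell r d0 C L G J (T : Type) (A : set T) (k : T -> 'I_n.+1 -> nat)
    (xk : T -> 'rV[R]_n.+1) (l s : R) (m : nat) :
  0 < s -> 0 <= C -> 0 <= L -> 0 <= l -> l <= d0 -> quadratic_remainder r d0 C L G J ->
  (forall t, A t -> [/\ `|xk t| <= r, forall i, G (xk t) 0 i = s * (k t i)%:R &
                        \det (J (xk t)) = 0]) ->
  (forall t t', A t -> A t' -> `|xk t - xk t'| <= l) ->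
  L * l < s * m%:R -> 2 * n.+1%:R * C * l ^+ 2 < s * 2%:R ->
  exists i0, forall t t', A t -> A t' ->
    (forall i, i != i0 -> k t i = k t' i %[mod m]) -> k t i0 = k t' i0 %[mod 2] ->
    k t = k t'.
Proof.
move=> s0 C0 L0 l0 ld0 qr HA Hl Lm sl.
have [[t0 At0]|no] := pselect (exists t, A t); last first.
  by exists ord0 => t t' At; case: no; exists t.
(* All critical points of the cell are compared with this one; a single linearisation serves the
   whole cell and makes [i0] common to all pairs. *)
have [x0r Gx0 dJ0] := HA t0 At0.
have [v [i0 [vi0 vmax vJ]]] := singular_functional dJ0.
exists i0 => t t' At At' eqm eq2.
have [xr Gx _] := HA t At; have [xr' Gx' _] := HA t' At'.
have eqk i : i != i0 -> k t i = k t' i.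
  move=> /eqm; apply: eqmod_close s0 Lm _; rewrite -Gx -Gx'.
  have [_ h] := qr _ _ xr' xr (le_trans (Hl _ _ At At') ld0).
  have := coord_le_norm (G (xk t) - G (xk t')) i; rewrite !mxE => h'.
  by apply: le_trans h' _; apply: le_trans h _; rewrite ler_wpM2l // Hl.
have slab (z : T) : A z -> `|dotr (G (xk z) - G (xk t0)) v| <= n.+1%:R * (C * l ^+ 2) * `|v 0 i0|.
  move=> Az; have [zr _ _] := HA z Az.
  have zl := Hl z t0 Az At0.
  have [h _] := qr _ _ x0r zr (le_trans zl ld0).
  have -> : dotr (G (xk z) - G (xk t0)) v =
            dotr (G (xk z) - G (xk t0) - (xk z - xk t0) *m J (xk t0)) v.
    by rewrite [RHS]dotrB vJ subr0.
  apply: dotr_le => //; first by rewrite mulr_ge0 // sqr_ge0.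
  by apply: le_trans h _; rewrite ler_wpM2l // lerXn2r ?nnegrE.
have slab2 : `|dotr (G (xk t) - G (xk t')) v| <= 2 * n.+1%:R * C * l ^+ 2 * `|v 0 i0|.
  rewrite (_ : G (xk t) - G (xk t') = (G (xk t) - G (xk t0)) - (G (xk t') - G (xk t0))); last first.
    by rewrite opprB addrA subrK.
  rewrite dotrB; apply: le_trans (ler_normB _ _) _.
  have := slab t At; have := slab t' At'; clear; lra.
have dE : dotr (G (xk t) - G (xk t')) v = (s * (k t i0)%:R - s * (k t' i0)%:R) * v 0 i0.
  rewrite /dotr (bigD1 i0) //= big1 ?addr0; first by rewrite !mxE Gx Gx'.
  by move=> i ii0; rewrite !mxE Gx Gx' eqk // subrr mul0r.
apply/funext => i; have [->|] := eqVneq i i0; last exact: eqk.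
apply: eqmod_close s0 sl _ eq2.
by move: slab2; rewrite dE normrM ler_pM2r // normr_gt0.
Qed.

(** There are N + 1 indices because the face [a = r] has index N. *)
Lemma cell_index_close (r l a b : R) N : 0 < l -> l * N%:R = 2 * r ->
  `|a| <= r -> `|b| <= r ->
  (inord (Num.truncn ((a + r) / l)) : 'I_N.+1) = inord (Num.truncn ((b + r) / l)) ->
  `|a - b| <= l.
Proof.
move=> l0 lN ar br.
have itv c : `|c| <= r -> 0 <= (c + r) / l /\ (Num.truncn ((c + r) / l) < N.+1)%N.
  rewrite ler_norml => /andP[c1 c2].
  have c0 : 0 <= (c + r) / l by rewrite divr_ge0 ?(ltW l0) // -lerBlDr sub0r.
  split=> //; rewrite ltnS -(ler_nat R) -(ler_pM2l l0) lN.
  have : l * (Num.truncn ((c + r) / l))%:R <= c + r.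
    by rewrite mulrC -ler_pdivlMr // truncn_le.
  by move: c2; clear; lra.
have [a0 aN] := itv a ar; have [b0 bN] := itv b br.
move=> /(congr1 val) /=; rewrite !inordK // => e.
have /truncn_itv := a0; have /truncn_itv := b0; rewrite e -natr1.
rewrite !ler_pdivlMr // !ltr_pdivrMr // ler_norml.
by clear; lra.
Qed.

(** After N + 1 <= 2 N with N = B T, both sides contain (B T)^(n1+1) T^n1; what remains is a
    constant on the left and one further factor T on the right. *)
Lemma grid_pigeonhole (n1 B T a : nat) : (0 < B)%N ->
  (2 ^ n1.+2 * a ^ n1 * B ^ n1 < T)%N ->
  ((B * T).+1 ^ n1.+1 * (2 * (a * (B * T)) ^ n1) < (B * T ^ 2) ^ n1.+1)%N.
Proof.
move=> B0 ltT; have T0 : (0 < T)%N by apply: leq_ltn_trans ltT.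
have BT0 : (0 < B * T)%N by rewrite muln_gt0 B0.
apply: (@leq_ltn_trans ((2 * (B * T)) ^ n1.+1 * (2 * (a * (B * T)) ^ n1))).
  by apply: leq_mul => //; rewrite leq_exp2r // -[(B * T).+1]addn1 mul2n -addnn leq_add2l.
have -> : ((2 * (B * T)) ^ n1.+1 * (2 * (a * (B * T)) ^ n1) =
  (2 ^ n1.+2 * a ^ n1 * B ^ n1) * ((B * T) ^ n1.+1 * T ^ n1))%N.
  by rewrite !expnMn !expnS; ring.
have -> : ((B * T ^ 2) ^ n1.+1 = T * ((B * T) ^ n1.+1 * T ^ n1))%N.
  by rewrite -mulnn mulnA expnMn [in X in (_ * X)%N]expnS; ring.
by rewrite ltn_pmul2r // muln_gt0 !expn_gt0 T0 BT0.
Qed.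

Lemma sard_quadratic r d0 C L G J (eta : R) :
  0 < r -> 0 < d0 -> 0 < C -> 0 < L -> 0 < eta -> quadratic_remainder r d0 C L G J ->
  exists2 p : 'rV[R]_n.+1, `|p| < eta &
    forall x, `|x| <= r -> G x = p -> \det (J x) != 0.
Proof.
move=> r0 d00 C0 L0 eta0 qr; apply: contrapT => none.
have crit (p : 'rV[R]_n.+1) : `|p| < eta ->
    exists x, [/\ `|x| <= r, G x = p & \det (J x) = 0].
  move=> peta; apply: contrapT => nx; apply: none; exists p => // x xr Gx.
  by apply/eqP => dJ; apply: nx; exists x.
have c0 : 0 < n.+1%:R * C :> R by rewrite mulr_gt0.
have r2 : 0 < 2 * r by rewrite mulr_gt0.
(* With N = B T cells per side and K = B T^2 values per side, critical points
   attain at most O(N^(n+1) N^n) of the K^(n+1) ~ T^(2n+2) values. *)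
pose B := (Num.truncn (2 * (n.+1%:R * C) * (2 * r) ^+ 2 / eta + 2 * r / d0)).+1.
pose a := (Num.truncn (L / (n.+1%:R * C * (2 * r)))).+1.
(* Chosen last: [B] and [a] settle all metric conditions independently of [T], which then only has
   to beat the counting constants. *)
pose T := (2 ^ n.+2 * a ^ n * B ^ n).+1.
pose N := (B * T)%N.
have B0 : 0 < B%:R :> R by rewrite ltr0n.
have T0 : 0 < T%:R :> R by rewrite ltr0n.
have T1 : 1 <= T%:R :> R by rewrite ler1n.
have N0 : 0 < N%:R :> R by rewrite ltr0n muln_gt0.
have NE : N%:R = B%:R * T%:R :> R by rewrite natrM.
have q1 : 0 <= 2 * (n.+1%:R * C) * (2 * r) ^+ 2 / eta.
  by rewrite divr_ge0 ?(ltW eta0) // mulr_ge0 ?sqr_ge0 // mulr_ge0 // ltW.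
have q2 : 0 <= 2 * r / d0 by rewrite divr_ge0 // ltW.
have BE := ltW (truncnS_gt (2 * (n.+1%:R * C) * (2 * r) ^+ 2 / eta + 2 * r / d0)).
rewrite -/B in BE.
(* The first summand of [B] keeps the lattice of values within eta, the second makes the cells
   smaller than [d0]. *)
have BE1 : 2 * (n.+1%:R * C) * (2 * r) ^+ 2 / B%:R <= eta.
  rewrite ler_pdivrMr // [eta * _]mulrC -ler_pdivrMr //.
  by apply: le_trans BE; rewrite lerDl.
have BE2 : 2 * r / B%:R <= d0.
  rewrite ler_pdivrMr // [d0 * _]mulrC -ler_pdivrMr //.
  by apply: le_trans BE; rewrite lerDr.
pose l := 2 * r / N%:R; have l0 : 0 < l by rewrite divr_gt0.
have lN : l * N%:R = 2 * r by rewrite /l divfK // gt_eqF.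
have ld0 : l <= d0.
  apply: le_trans BE2; rewrite /l ler_pM2l // lef_pV2 ?posrE // NE.
  by rewrite ler_peMr // ltW.
(* The lattice step equals the width of the slab of critical values of a cell, so two lattice values
   in it that agree in the other coordinates are told apart by parity. *)
pose s := 2 * (n.+1%:R * C) * l ^+ 2.
have s0 : 0 < s by rewrite /s mulr_gt0 ?exprn_gt0 // mulr_gt0.
pose K := (B * T ^ 2)%N.
have sK : s * K%:R <= eta.
  rewrite (_ : s * K%:R = 2 * (n.+1%:R * C) * (2 * r) ^+ 2 / B%:R) //.
  rewrite /s /l NE natrM natrX; field.
  by rewrite !gt_eqF.
pose m := (a * N)%N.
have Lm : L * l < s * m%:R.
  have := truncnS_gt (L / (n.+1%:R * C * (2 * r))); rewrite -/a.
  rewrite ltr_pdivrMr ?mulr_gt0 // => h.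
  have -> : s * m%:R = 2 * (a%:R * (n.+1%:R * C * (2 * r))) * l.
    rewrite /s /m natrM (_ : _ * (a%:R * N%:R) = 2 * (n.+1%:R * C) * l * a%:R * (l * N%:R)).
      by rewrite lN; ring.
    by ring.
  by rewrite ltr_pM2r //; move: h L0; clear; lra.
pose p (k : {ffun 'I_n.+1 -> 'I_K}) : 'rV[R]_n.+1 := \row_i (s * (k i)%:R).
have pk k : `|p k| < eta.
  apply: row_norm_lt => // i; rewrite mxE ger0_norm; last first.
    by apply: mulr_ge0 => //; exact: ltW.
  by apply: lt_le_trans sK; rewrite ltr_pM2l // ltr_nat.
have /choice[xk Hxk] := fun k => crit (p k) (pk k).
pose cell k : {ffun 'I_n.+1 -> 'I_N.+1} :=
  [ffun i => inord (Num.truncn ((xk k 0 i + r) / l))].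
have close k k' : cell k = cell k' -> `|xk k - xk k'| <= l.
  move=> e; apply: row_norm_le => [|i]; first exact: ltW.
  rewrite !mxE; have [xr _ _] := Hxk k; have [xr' _ _] := Hxk k'.
  apply: (cell_index_close (N := N) l0 lN (le_trans (coord_le_norm _ i) xr)
    (le_trans (coord_le_norm _ i) xr')).
  by have /ffunP/(_ i) := e; rewrite !ffunE.
have /choice[i0 Hi0] : forall c, exists i0, forall k k', cell k = c -> cell k' = c ->
    (forall i, i != i0 -> k i = k' i %[mod m]) -> k i0 = k' i0 %[mod 2] ->
    (fun i => k i : nat) = (fun i => k' i : nat).
  move=> c; apply: (@critical_values_cell r d0 C L G J _ [set k | cell k = c]
    (fun k i => k i : nat) xk l s m s0 (ltW C0) (ltW L0) (ltW l0) ld0 qr _ _ Lm).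
  - move=> k _; have [xr Gx dJ] := Hxk k; split=> // i.
    by rewrite Gx mxE.
  - by move=> k k' /= <- e; apply: close.
  - have -> : 2 * n.+1%:R * C * l ^+ 2 = s by rewrite /s; ring.
    by rewrite ltr_pMr // ltr1n.
have m0 : (0 < m)%N by rewrite !muln_gt0.
have KE : K = K.-1.+1 by rewrite prednK // muln_gt0.
pose Phi (k : {ffun 'I_n.+1 -> 'I_K}) :=
  (cell k, ((inord (k (i0 (cell k)) %% 2) : 'I_2),
   ([ffun j => Ordinal (ltn_pmod (k (lift (i0 (cell k)) j)) m0)] : {ffun 'I_n -> 'I_m}))).
have Phi_inj : injective Phi.
  move=> k k' /pair_equal_spec[ec /pair_equal_spec[e2 em]].
  have H := Hi0 (cell k) k k' erefl (esym ec).
  apply/ffunP => i; apply/val_inj.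
  have {}H : (fun i => k i : nat) = (fun i => k' i : nat).
    apply: H => [j ji|].
      case: (unliftP (i0 (cell k)) j) => [j' je|je]; last by rewrite je eqxx in ji.
      by have /ffunP/(_ j') := em; rewrite !ffunE -ec -je => /(congr1 val).
    by move/(congr1 val): e2; rewrite /= !inordK ?ltn_pmod // -ec.
  by have := congr1 (fun f => f i) H.
have := leq_card Phi Phi_inj; rewrite !card_prod !card_ffun !card_ord leqNgt.
by rewrite grid_pigeonhole.
Qed.

End Sard.

(** * Maps with exponential terms and their regular approximations *)

Lemma expR_taylor1 (R : realType) (d : R) : `|d| <= 1 / 2 ->
  `|expR d - 1 - d| <= 2 * d ^+ 2.
Proof.
rewrite ler_norml => /andP[d1 d2].
have h1 := expR_ge1Dx d.
(* The upper estimate also comes from 1 + x <= exp x, taken at x = -d. *)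
have h2 : expR d * (1 - d) <= 1.
  rewrite -[leRHS](expR0 R) -(subrr d) expRD ler_pM2l ?expR_gt0 //.
  exact: expR_ge1Dx.
rewrite ger0_norm; last by move: h1; clear; lra.
have h3 : 0 < 1 - d by move: d2; clear; lra.
rewrite -(ler_pM2r h3); have : 0 <= d ^+ 2 * (1 - 2 * d).
  by rewrite mulr_ge0 ?sqr_ge0 //; move: d2; clear; lra.
by move: h2; rewrite expr2; clear; lra.
Qed.

Section ExpMap.
Variables (R : realType) (n : nat).
Implicit Types (L : 'M[R]_n) (c al be x y v : 'rV[R]_n).

(** A family closed under directional derivatives ([expmap_derive]) and under adding constants: C^2
    reduces to differentiability within the family, and a perturbation by a constant stays in it. *)
Definition expmap L c al be : 'rV[R]_n -> 'rV[R]_n := fun x =>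
  x *m L + c + \row_i (al 0 i * expR (2 * x 0 i) + be 0 i * expR (x 0 i)).

Definition expmap_jac L al be x : 'M[R]_n :=
  L + diag_mx (\row_i (2 * al 0 i * expR (2 * x 0 i) + be 0 i * expR (x 0 i))).

Lemma expmap_jacE L c al be x v :
  v *m expmap_jac L al be x =
  expmap 0 (v *m L) (\row_i (2 * al 0 i * v 0 i)) (\row_i (be 0 i * v 0 i)) x.
Proof.
apply/rowP => i; rewrite /expmap /expmap_jac mulmxDr mulmx0 add0r mul_mx_diag.
by rewrite !mxE; ring.
Qed.

Lemma expmap_remainder L c al be (r : R) : 0 <= r -> exists2 C, 0 < C &
  forall x y, `|x| <= r -> `|y - x| <= 1 / 4 ->
  `|expmap L c al be y - expmap L c al be x - (y - x) *m expmap_jac L al be x|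
    <= C * `|y - x| ^+ 2.
Proof.
move=> r0; pose A := 1 + `|al| + `|be|.
have A0 : 0 < A by rewrite /A -addrA ltr_pwDl // addr_ge0.
pose E := expR (2 * r).
have E0 : 0 < E := expR_gt0 _.
(* 10 = 8 + 2, from the remainders 2 (2 d)^2 and 2 d^2 of the two exponentials; |d| <= 1/4 allows
   [expR_taylor1] at 2 d. *)
exists (10 * A * E); first by rewrite !mulr_gt0.
move=> x y xr yx; apply: row_norm_le => [|i].
  by rewrite mulr_ge0 ?sqr_ge0 // !mulr_ge0 ?ltW.
have -> : (expmap L c al be y - expmap L c al be x - (y - x) *m expmap_jac L al be x) 0 i =
  al 0 i * expR (2 * x 0 i) * (expR (2 * (y - x) 0 i) - 1 - 2 * (y - x) 0 i) +
  be 0 i * expR (x 0 i) * (expR ((y - x) 0 i) - 1 - (y - x) 0 i).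
  rewrite /expmap /expmap_jac mulmxDr mul_mx_diag mulmxBl !mxE.
  have -> : expR (2 * y 0 i) = expR (2 * x 0 i) * expR (2 * (y 0 i - x 0 i)).
    by rewrite -expRD; congr expR; ring.
  have -> : expR (y 0 i) = expR (x 0 i) * expR (y 0 i - x 0 i).
    by rewrite -expRD; congr expR; ring.
  by ring.
have di := coord_le_norm (y - x) i; move: ((y - x) 0 i) di => d di.
have d14 := le_trans di yx.
have xi : `|x 0 i| <= r := le_trans (coord_le_norm x i) xr.
have xr' : x 0 i <= r := le_trans (ler_norm _) xi.
have e1 : expR (2 * x 0 i) <= E by rewrite ler_expR ler_pM2l.
have e2 : expR (x 0 i) <= E by rewrite ler_expR; move: r0 xr'; clear; lra.
have ali : `|al 0 i| <= A.
  by have := coord_le_norm al i; have := normr_ge0 be; rewrite /A; clear; lra.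
have bei : `|be 0 i| <= A.
  by have := coord_le_norm be i; have := normr_ge0 al; rewrite /A; clear; lra.
have d2 : d ^+ 2 <= `|y - x| ^+ 2 by rewrite -[d ^+ 2]ger0_norm ?sqr_ge0 // normrX lerXn2r ?nnegrE.
have t1 : `|expR (2 * d) - 1 - 2 * d| <= 2 * (2 * d) ^+ 2.
  by apply: expR_taylor1; rewrite normrM ger0_norm //; move: d14; clear; lra.
have t2 : `|expR d - 1 - d| <= 2 * d ^+ 2.
  by apply: expR_taylor1; move: d14; clear; lra.
have AE : 0 <= A * E by rewrite mulr_ge0 ?ltW.
apply: le_trans (ler_normD _ _) _; rewrite !normrM.
rewrite (ger0_norm (expR_ge0 _)) (ger0_norm (expR_ge0 _)).
apply: (@le_trans _ _ (A * E * (2 * (2 * d) ^+ 2) + A * E * (2 * d ^+ 2))).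
  by apply: lerD; apply: ler_pM => //; rewrite ?mulr_ge0 ?expR_ge0 //; apply: ler_pM => //; exact: expR_ge0.
have -> : A * E * (2 * (2 * d) ^+ 2) + A * E * (2 * d ^+ 2) = 10 * A * E * d ^+ 2 by ring.
by rewrite ler_wpM2l // !mulr_ge0 ?ltW.
Qed.

Lemma expmap_lipschitz L c al be (r : R) : 0 <= r -> exists2 C, 0 < C &
  forall x y, `|x| <= r -> `|y - x| <= 1 / 4 ->
  `|expmap L c al be y - expmap L c al be x| <= C * `|y - x|.
Proof.
move=> r0; have [C C0 HC] := expmap_remainder L c al be r0.
have [C' C'0 HC'] := mulmx_norm_le L.
pose A := 1 + 2 * `|al| + `|be|.
pose E := expR (2 * r).
have E0 : 0 < E := expR_gt0 _.
have A0 : 0 < A by rewrite /A -addrA ltr_pwDl // addr_ge0 // mulr_ge0.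
exists (C + C' + A * E); first by rewrite !addr_gt0 // mulr_gt0.
move=> x y xr yx.
have h1 := HC x y xr yx.
have h2 : C * `|y - x| ^+ 2 <= C * `|y - x|.
  rewrite ler_pM2l // expr2 ler_piMr //; move: yx; clear; lra.
have h3 : `|(y - x) *m expmap_jac L al be x| <= (C' + A * E) * `|y - x|.
  rewrite /expmap_jac mulmxDr mulrDl; apply: le_trans (ler_normD _ _) _.
  apply: lerD (HC' _) _; apply: row_norm_le => [|i]; first by rewrite mulr_ge0 // mulr_ge0 ?ltW.
  rewrite mul_mx_diag mxE normrM mulrC [(_ - _ : 'rV__)]lock mxE -lock.
  have xi : `|x 0 i| <= r := le_trans (coord_le_norm x i) xr.
  have xr' : x 0 i <= r := le_trans (ler_norm _) xi.
  apply: ler_pM => //; last exact: coord_le_norm.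
  apply: le_trans (ler_normD _ _) _; rewrite !normrM (ger0_norm (expR_ge0 _)) (ger0_norm (expR_ge0 _)).
  have e1 : expR (2 * x 0 i) <= E by rewrite ler_expR ler_pM2l.
  have e2 : expR (x 0 i) <= E by rewrite ler_expR; move: r0 xr'; clear; lra.
  apply: (@le_trans _ _ (2 * `|al| * E + `|be| * E)); last first.
    by rewrite -mulrDl ler_pM2r // /A -addrA lerDr.
  apply: lerD; apply: ler_pM; rewrite ?expR_ge0 ?mulr_ge0 //; last exact: coord_le_norm.
  by rewrite ger0_norm // ler_pM2l // coord_le_norm.
have -> : expmap L c al be y - expmap L c al be x =
  (expmap L c al be y - expmap L c al be x - (y - x) *m expmap_jac L al be x) +
  (y - x) *m expmap_jac L al be x by rewrite subrK.
apply: le_trans (ler_normD _ _) _; move: h1 h2 h3; clear.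
by move: `|_ - _ - _| => u; lra.
Qed.

Lemma expmap_differentiable L c al be x :
  differentiable (expmap L c al be) x /\
  'd (expmap L c al be) x = mulmx^~ (expmap_jac L al be x) :> (_ -> _).
Proof.
set J := expmap_jac L al be x.
have [C C0 HC] := expmap_remainder L c al be (normr_ge0 x).
have cJ : continuous (fun v : 'rV[R]_n => v *m J) := @mulmxr_continuous R n J.
have lo (df : 'rV[R]_n -> 'rV[R]_n) : df = mulmx^~ J ->
    expmap L c al be \o shift x = cst (expmap L c al be x) + df +o_ (0 : 'rV[R]_n) id.
  move=> ->; apply/eqaddoP => e e0.
  apply/nbhs_ballP; exists (Num.min (1 / 4) (e / C)).
    by rewrite /= lt_min !divr_gt0.
  move=> v; rewrite -ball_normE /= sub0r normrN lt_min => /andP[v1 v2].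
  have := HC x (v + x) (lexx _); rewrite addrK => /(_ (ltW v1)) h.
  rewrite !fctE /= opprD addrA.
  apply: le_trans h _; rewrite expr2 mulrA ler_wpM2r //.
  by rewrite mulrC -ler_pdivlMr // ltW.
have dE : 'd (expmap L c al be) x = mulmxr J :> (_ -> _).
  by apply: diff_unique; [exact: cJ | exact: lo].
split; last exact: dE.
by apply/diff_locallyP; rewrite dE; split; [exact: cJ | exact: lo].
Qed.
Lemma expmap_jacobian L c al be x : 'J (expmap L c al be) x = expmap_jac L al be x.
Proof.
have [_ dE] := expmap_differentiable L c al be x.
apply/row_matrixP => i; rewrite !rowE /jacobian mul_rV_lin1.
by rewrite -[RHS]/(mulmx^~ (expmap_jac L al be x) (delta_mx 0 i)) -dE.
Qed.

Lemma expmap_derive L c al be v : 'D_v (expmap L c al be) =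
  expmap 0 (v *m L) (\row_i (2 * al 0 i * v 0 i)) (\row_i (be 0 i * v 0 i)).
Proof.
apply/funext => x; have [dF _] := expmap_differentiable L c al be x.
by rewrite deriveEjacobian // expmap_jacobian expmap_jacE.
Qed.

Lemma expmap_continuous L c al be : continuous (expmap L c al be).
Proof.
move=> x; apply: differentiable_continuous.
by case: (expmap_differentiable L c al be x).
Qed.

Lemma expmap_C1 L c al be : C1_map (expmap L c al be).
Proof.
split=> [x|v]; first by case: (expmap_differentiable L c al be x).
by rewrite expmap_derive; exact: expmap_continuous.
Qed.

Lemma expmap_C2 L c al be : C2_map (expmap L c al be).
Proof.
split=> [x|v]; first by case: (expmap_differentiable L c al be x).
by rewrite expmap_derive; exact: expmap_C1.
Qed.

End ExpMap.

(** The approximation subtracts a regular value smaller than the minimum of the norm on the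
    sphere. *)
Lemma expmap_regular_approx (R : realType) n (L : 'M[R]_n) c al be (r : R)
  (D := [set x : 'rV[R]_n | `|x| < r]) :
  (0 < n)%N -> 0 < r -> (forall x, `|x| = r -> expmap L c al be x != 0) ->
  exists G, regular_approx (expmap L c al be) D 0 G.
Proof.
case: n L c al be @D => // n L c al be D _ r0 ne0.
have [||m m0 Hm] := @compact_pos_lb R _ _ (fun x => `|expmap L c al be x|) (@compact_sphere R n.+1 r).
- by move=> x; exact: cvg_norm (@expmap_continuous R n.+1 L c al be x).
- by move=> x xr; rewrite normr_gt0 ne0.
have [C C0 HC] := expmap_remainder L c al be (ltW r0).
have [C' C'0 HC'] := expmap_lipschitz L c al be (ltW r0).
have d0 : 0 < 1 / 4 :> R by rewrite divr_gt0.
have [|p pm Hp] := @sard_quadratic R n r (1 / 4) C C' (expmap L c al be)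
  (expmap_jac L al be) m r0 d0 C0 C'0 m0.
  by move=> x y xr _ yx; split; [exact: HC | exact: HC'].
have GE x : expmap L (c - p) al be x = expmap L c al be x - p.
  by rewrite /expmap addrA !(addrAC _ (- p)).
exists (expmap L (c - p) al be); split; first exact: expmap_C2.
  move=> x /ltW xr; rewrite GE => /eqP; rewrite subr_eq0 => /eqP Fx.
  by rewrite expmap_jacobian; exact: Hp.
exists m; first by move=> x /bdry_sub_sphere xr; rewrite subr0; exact: Hm.
by move=> x _; rewrite GE addrAC subrr sub0r normrN.
Qed.

(** * Estimates on the graph *)

Section Reaction.
Variable R : realType.
Implicit Types s t : R.

Definition chern_simons s : R := expR s * (expR s - 1).

Lemma chern_simons_ge s : - (1 / 4) <= chern_simons s.
Proof.
rewrite /chern_simons -subr_ge0.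
rewrite (_ : _ - _ = (expR s - 1 / 2) ^+ 2); last by field.
exact: sqr_ge0.
Qed.

Lemma chern_simons_le s c : 0 <= c -> chern_simons s <= c -> expR s <= 1 + c.
Proof.
move=> c0; rewrite /chern_simons => le; rewrite leNgt; apply/negP => lt.
have h : (1 + c) * c < expR s * (expR s - 1).
  apply: ltr_pM => //; first by rewrite addr_ge0.
  by move: lt; clear; lra.
have : 0 <= c * c by rewrite mulr_ge0.
by move: h le; clear; lra.
Qed.

Lemma expR_gt_id s : s < expR s.
Proof. by have := expR_ge1Dx s; lra. Qed.

(** The factor [expR s] is kept because it makes the reaction small where s is very negative. *)
Lemma chern_simons_norm_le s c : expR s <= c -> `|chern_simons s| <= expR s * (1 + c).
Proof.
move=> sc; have e0 := expR_gt0 s; rewrite normrM gtr0_norm // ler_pM2l //.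
by rewrite ler_norml; move: e0 sc; clear; lra.
Qed.

Lemma chern_simons_gt0 s : 0 < s -> s <= chern_simons s.
Proof.
move=> s0; have := expR_ge1Dx s; rewrite /chern_simons => h.
by apply: (@le_trans _ _ (1 * s)); [rewrite mul1r | apply: ler_pM; lra].
Qed.

Lemma chern_simons_lt0 s : s < 0 -> chern_simons s < 0.
Proof.
by move=> s0; rewrite /chern_simons pmulr_rlt0 ?expR_gt0 // subr_lt0 expR_lt1.
Qed.

End Reaction.

Section Graph.
Variables (R : realType) (V : finType) (E : rel V) (mu : V -> R) (w : V -> V -> R).
Hypothesis E_sym : symmetric E.
Hypothesis E_conn : forall x y : V, connect E x y.
Hypothesis mu_gt0 : forall x, 0 < mu x.
Hypothesis w_gt0 : forall x y, E x y -> 0 < w x y.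
Hypothesis w_sym : forall x y, E x y -> w x y = w y x.
Implicit Types u g : V -> R.

Local Notation lap := (laplacian E mu w).
Local Notation integ := (integralV mu).

Lemma integral_laplacian u : integ (lap u) = 0.
Proof.
rewrite /integralV /laplacian.
under eq_bigr => x _ do rewrite mulrA mulfV ?gt_eqF // mul1r.
have anti : \sum_x \sum_(y | E x y) w x y * (u y - u x) =
            - \sum_x \sum_(y | E x y) w x y * (u y - u x).
  rewrite [LHS](exchange_big_dep predT) //= -sumrN; apply: eq_bigr => x _.
  rewrite -sumrN; apply: eq_big => [y|y Exy]; first by rewrite E_sym.
  by rewrite w_sym // -mulrN opprB.
by move: (\sum_x _) anti => S; lra.
Qed.

Lemma laplacian_max u x : (forall y, u y <= u x) -> lap u x <= 0.
Proof.
move=> ux; rewrite /laplacian mulr_ge0_le0 ?invr_ge0 ?(ltW (mu_gt0 x)) //.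
by apply: sumr_le0 => y Exy; rewrite mulr_ge0_le0 ?(ltW (w_gt0 Exy)) // subr_le0.
Qed.

Lemma laplacianN u : lap (fun x => - u x) = fun x => - lap u x.
Proof.
apply/funext => x; rewrite /laplacian -mulrN -sumrN; congr (_ * _).
by apply: eq_bigr => y _; ring.
Qed.

Lemma laplacian_min u x : (forall y, u x <= u y) -> 0 <= lap u x.
Proof.
move=> ux; rewrite -oppr_le0 -[- _]/((fun x => - lap u x) x) -laplacianN.
by apply: laplacian_max => y; rewrite lerN2.
Qed.

Lemma exists_max u (x0 : V) : exists x, forall y, u y <= u x.
Proof.
exists [arg max_(x > x0) u x]%O; case: arg_maxP => // x _ H y; exact: H.
Qed.

Lemma exists_min u (x0 : V) : exists x, forall y, u x <= u y.
Proof.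
exists [arg min_(x < x0) u x]%O; case: arg_minP => // x _ H y; exact: H.
Qed.

Lemma positive_lb (I : finType) (P : pred I) (F : I -> R) :
  (forall i, P i -> 0 < F i) -> exists2 c, 0 < c & forall i, P i -> c <= F i.
Proof.
move=> F0; exists (\big[Num.min/1]_(i | P i) F i).
  by apply: lt_bigmin => // i; exact: F0.
by move=> i Pi; apply: bigmin_le_cond.
Qed.

(** Follow a path from a minimum point x0. At a vertex a the Laplacian bounds the weighted sum of
    the differences to the neighbours, and none of these lies below u x0; so a neighbour exceeds u a
    by at most a multiple of K and of the excess u a - u x0 reached so far. *)
Lemma oscillation : exists2 C, 0 < C & forall u K, 0 <= K ->
  (forall x, `|lap u x| <= K) -> forall x y, u y - u x <= C * K.
Proof.
have [wm wm0 Hwm] := @positive_lb (V * V)%type (fun p => E p.1 p.2)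
  (fun p => w p.1 p.2) (fun p => @w_gt0 p.1 p.2).
pose Q := (\sum_x mu x + \sum_x \sum_(y | E x y) w x y) / wm.
have mS x : mu x <= \sum_x mu x.
  by rewrite (bigD1 x) //= lerDl sumr_ge0 // => y _; exact: ltW.
have ws0 x : 0 <= \sum_(y | E x y) w x y by apply: sumr_ge0 => y /w_gt0/ltW.
have wS x : \sum_(y | E x y) w x y <= \sum_x \sum_(y | E x y) w x y.
  by rewrite [leRHS](bigD1 x) //= lerDl sumr_ge0.
have Sm0 : 0 <= \sum_x mu x by apply: sumr_ge0 => x _; exact: ltW.
have Sw0 : 0 <= \sum_x \sum_(y | E x y) w x y by apply: sumr_ge0.
have Q0 : 0 <= Q by rewrite divr_ge0 ?addr_ge0 // ltW.
(* [c k] bounds the excess over the minimum after k edges, in units of K; a path without repetitions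
   has fewer than #|V| edges. *)
pose c := fix c k : R := if k is k'.+1 then c k' + Q * (1 + c k') else 0.
have c0 k : 0 <= c k by elim: k => //= k IH; rewrite addr_ge0 // mulr_ge0 // addr_ge0.
have cmono k l : (k <= l)%N -> c k <= c l.
  move=> /subnK <-; elim: (l - k)%N => //= j IH; apply: le_trans IH _.
  by rewrite lerDl mulr_ge0 // addr_ge0.
exists (1 + c #|V|); first by rewrite ltr_pwDl.
move=> u K K0 HK x y.
have [x0 ux0] := exists_min u x.
suff : u y - u x0 <= c #|V| * K.
  move=> h; apply: (@le_trans _ _ (u y - u x0)); first by rewrite lerD2l lerN2.
  by apply: le_trans h _; rewrite mulrDl lerDr mul1r.
have [p0 pE yE] := connectP (E_conn x0 y).
case/shortenP: pE yE => p pE pu _ ->.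
have psz : (size p < #|V|)%N by have := card_uniqP pu => /= <-; exact: max_card.
suff H : u (last x0 p) - u x0 <= c (size p) * K.
  by apply: le_trans H _; rewrite ler_wpM2r // cmono // ltnW.
move: pE {pu psz}; elim/last_ind: p => [_|p z IH] /=; first by rewrite subrr mul0r.
rewrite rcons_path last_rcons size_rcons => /andP[/IH{}IH Ez] /=.
move: (last x0 p) IH Ez => a IH Ez.
have lapa : \sum_(y | E a y) w a y * (u y - u a) <= (\sum_x mu x) * K.
  have := HK a; rewrite /laplacian ler_norml => /andP[_].
  rewrite mulrC ler_pdivrMr // mulrC => h; apply: le_trans h _.
  by rewrite ler_wpM2r.
have rest : - ((\sum_x \sum_(y | E x y) w x y) * (c (size p) * K)) <=
    \sum_(y | E a y && (y != z)) w a y * (u y - u a).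
  apply: (@le_trans _ _ (\sum_(y | E a y && (y != z)) w a y * - (c (size p) * K))).
    rewrite -mulr_suml mulrN lerN2 ler_wpM2r ?mulr_ge0 //.
    apply: le_trans (wS a); rewrite [leRHS](bigID (fun y => y != z)) /= lerDl.
    by apply: sumr_ge0 => t /andP[/w_gt0/ltW].
  apply: ler_sum => t /andP[Et _]; rewrite ler_wpM2l ?(ltW (w_gt0 Et)) //.
  by have := ux0 t; move: IH; lra.
have wz : wm * (u z - u a) <= (\sum_x mu x + (\sum_x \sum_(y | E x y) w x y)) * K * (1 + c (size p)).
  have h1 : w a z * (u z - u a) <= (\sum_x mu x + (\sum_x \sum_(y | E x y) w x y)) * K * (1 + c (size p)).
    move: lapa; rewrite (bigD1 z) //= => h.
    have m1 : 0 <= (\sum_x \sum_(y | E x y) w x y) * K by rewrite mulr_ge0.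
    have m2 : 0 <= (\sum_x mu x) * K * c (size p) by rewrite !mulr_ge0.
    by move: h rest m1 m2; lra.
  have [uz|uz] := leP 0 (u z - u a).
    by apply: le_trans h1; rewrite ler_wpM2r // (Hwm (a, z)).
  apply: (@le_trans _ _ 0); first by rewrite mulr_ge0_le0 ?(ltW wm0) // ltW.
  by rewrite !mulr_ge0 // addr_ge0.
have : u z - u a <= Q * (1 + c (size p)) * K.
  rewrite /Q mulrC -(ler_pM2l wm0); apply: le_trans wz _.
  by rewrite le_eqVlt; apply/orP; left; apply/eqP; field; rewrite gt_eqF.
by move: IH; rewrite mulrDl; lra.
Qed.

Lemma harmonic_const u : (forall x, lap u x = 0) -> forall x y, u x = u y.
Proof.
move=> lu x y; have [C _ H] := oscillation.
have Hu a b : u a - u b <= 0.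
  by have := H u 0 (lexx _) _ b a; rewrite mulr0; apply => z; rewrite lu normr0.
by apply/eqP; rewrite eq_le -!(subr_le0 (u _)) !Hu.
Qed.

End Graph.

(** The integral condition is a separate hypothesis because at s = 0 the equation no longer contains
    the reaction and cannot imply it; with it the bound is uniform on all of [0, 1]. *)
Lemma a_priori (R : realType) (V : finType) (E : rel V) (mu : V -> R)
    (w : V -> V -> R) (E_conn : forall x y : V, connect E x y)
    (mu_gt0 : forall x, 0 < mu x) (w_gt0 : forall x y, E x y -> 0 < w x y)
    (lambda B kappa : R) :
  lambda != 0 -> 0 <= B -> 0 < kappa ->
  exists2 R0, 0 < R0 & forall s (g u : V -> R), 0 <= s <= 1 ->
    (forall x, `|g x| <= B) -> kappa <= `|integralV mu g| ->
    (forall x, - laplacian E mu w u x + s * (lambda * chern_simons (u x) + g x) = 0) ->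
    integralV mu (fun x => lambda * chern_simons (u x) + g x) = 0 ->
    forall x, `|u x| < R0.
Proof.
move=> l0 B0 k0.
have nl0 : 0 < `|lambda| by rewrite normr_gt0.
have [m m0 Hm] := @positive_lb R V predT mu (fun x _ => mu_gt0 x).
have [C C0 Hosc] := oscillation E_conn mu_gt0 w_gt0.
pose S := \sum_x mu x.
have S0 : 0 <= S by apply: sumr_ge0 => x _; exact: ltW.
(* Bound for one value of the reaction: the weighted sum is at most S B / |lambda|, the other
   vertices contribute at least - S / 4, and each weight is at least m. *)
pose c := (S * B / `|lambda| + S / 4) / m.
have c0 : 0 <= c.
  apply: divr_ge0; last exact: ltW.
  by apply: addr_ge0; [apply: divr_ge0; [exact: mulr_ge0|] | apply: divr_ge0].
pose K := `|lambda| * ((1 + c) * (2 + c)) + B.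
have K0 : 0 <= K by rewrite addr_ge0 // !mulr_ge0 // addr_ge0.
(* If u <= - P at one vertex, the oscillation bound gives exp u <= exp (C K) exp (- P) everywhere,
   so the integral of g is at most X exp (- P) in modulus. For P = X / kappa this is below kappa,
   since P < exp P. *)
pose X := `|lambda| * (S * ((2 + c) * expR (C * K))).
have X0 : 0 <= X by rewrite !mulr_ge0 ?expR_ge0 // addr_ge0.
pose P := X / kappa.
have P0 : 0 <= P by rewrite divr_ge0 // ltW.
exists (1 + c + P); first by rewrite -addrA ltr_pwDl // addr_ge0.
move=> s g u /andP[s0 s1] gB gk eqn int0 x.
have sumE : lambda * (\sum_y mu y * chern_simons (u y)) = - integralV mu g.
  apply/eqP; rewrite -addr_eq0; apply/eqP; rewrite -[RHS]int0.
  rewrite /integralV mulr_sumr -big_split /=; apply: eq_bigr => y _; ring.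
have gSB : `|integralV mu g| <= S * B.
  apply: le_trans (ler_norm_sum _ _ _) _; rewrite /S mulr_suml; apply: ler_sum => y _.
  by rewrite normrM gtr0_norm // ler_pM2l.
have normE : `|lambda| * `|\sum_y mu y * chern_simons (u y)| = `|integralV mu g|.
  by rewrite -normrM sumE normrN.
have csc y : chern_simons (u y) <= c.
  have h1 : \sum_y mu y * chern_simons (u y) <= S * B / `|lambda|.
    apply: le_trans (ler_norm _) _; rewrite ler_pdivlMr // mulrC normE; exact: gSB.
  have h2 : mu y * chern_simons (u y) <= S * B / `|lambda| + S / 4.
    move: h1; rewrite (bigD1 y) //= => h1.
    have : - (S / 4) <= \sum_(i | i != y) mu i * chern_simons (u i).
      apply: (@le_trans _ _ (\sum_(i | i != y) mu i * - (1 / 4))).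
        rewrite -mulr_suml mulrN lerN2 mul1r ler_pM2r ?invr_gt0 //.
        by rewrite /S [leRHS](bigD1 y) //= lerDr ltW.
      by apply: ler_sum => i _; rewrite ler_pM2l // chern_simons_ge.
    by move: h1; lra.
  rewrite /c ler_pdivlMr //; have [cs0|cs0] := leP 0 (chern_simons (u y)).
    by apply: le_trans h2; rewrite mulrC ler_wpM2r // Hm.
  apply: (@le_trans _ _ 0); first by rewrite mulr_le0_ge0 // ltW.
  by apply: addr_ge0; [apply: divr_ge0; [exact: mulr_ge0|] | apply: divr_ge0].
have exc y : expR (u y) <= 1 + c := chern_simons_le c0 (csc y).
have csn y : `|chern_simons (u y)| <= expR (u y) * (2 + c).
  by rewrite (_ : 2 + c = 1 + (1 + c)); [exact: chern_simons_norm_le | ring].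
have lapK y : `|laplacian E mu w u y| <= K.
  have -> : laplacian E mu w u y = s * (lambda * chern_simons (u y) + g y).
    by apply/eqP; rewrite -subr_eq0 -oppr_eq0 opprB addrC eqn.
  rewrite normrM ger0_norm //.
  apply: (@le_trans _ _ `|lambda * chern_simons (u y) + g y|); first by rewrite ler_piMl.
  apply: le_trans (ler_normD _ _) _; apply: lerD => //.
  rewrite normrM ler_pM2l //; apply: le_trans (csn y) _.
  by rewrite ler_wpM2r // addr_ge0.
rewrite ltr_norml; apply/andP; split; last first.
  apply: lt_le_trans (expR_gt_id _) _; apply: le_trans (exc x) _; by rewrite lerDl.
rewrite ltNge; apply/negP => ux.
have uP : u x <= - P by move: ux c0; lra.
have ey y : expR (u y) <= expR (C * K) * expR (- P).
  rewrite -expRD ler_expR; have := Hosc u K K0 lapK x y; move: uP; lra.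
have : kappa <= X * expR (- P).
  apply: le_trans gk _; rewrite -normE /X -mulrA ler_pM2l // -mulrA.
  apply: le_trans (ler_norm_sum _ _ _) _; rewrite /S mulr_suml; apply: ler_sum => y _.
  rewrite normrM gtr0_norm // ler_pM2l //; apply: le_trans (csn y) _.
  by rewrite mulrC -mulrA ler_wpM2l // addr_ge0.
rewrite (_ : X = kappa * P); last by rewrite /P mulrC divfK // gt_eqF.
rewrite -mulrA leNgt gtr_pMr // => /negP; apply.
by rewrite expRN ltr_pdivrMr ?expR_gt0 // mul1r expR_gt_id.
Qed.

(** * Grid degree of maps on vertex functions *)

Section VertexMaps.
Variables (R : realType) (V : finType).
Implicit Types (H : (V -> R) -> (V -> R)) (phi psi : (V -> R) -> R).

Definition cfun phi := continuous (fun x : 'rV[R]_#|V| => phi (of_coords x)).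

Lemma cfun_eval v : cfun (fun u => u v).
Proof. exact: coord_continuous. Qed.

Lemma cfun_cst (c : R) : cfun (fun=> c).
Proof. exact: cst_continuous. Qed.

Lemma cfunD phi psi : cfun phi -> cfun psi -> cfun (fun u => phi u + psi u).
Proof. by move=> h k x; exact: cvgD (h x) (k x). Qed.

Lemma cfunN phi : cfun phi -> cfun (fun u => - phi u).
Proof. by move=> h x; exact: cvgN (h x). Qed.

Lemma cfunM phi psi : cfun phi -> cfun psi -> cfun (fun u => phi u * psi u).
Proof. by move=> h k x; exact: cvgM (h x) (k x). Qed.

Lemma cfun_sum (P : pred V) (phi : V -> (V -> R) -> R) :
  (forall v, cfun (phi v)) -> cfun (fun u => \sum_(v | P v) phi v u).
Proof.
by move=> h; apply: continuous_big; [exact: add_continuous | move=> v _; exact: h].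
Qed.

Lemma cfun_expR phi : cfun phi -> cfun (fun u => expR (phi u)).
Proof. by move=> h x; apply: continuous_comp; [exact: h | exact: continuous_expR]. Qed.

Lemma cfun_chern_simons phi : cfun phi -> cfun (fun u => chern_simons (phi u)).
Proof.
move=> h; apply: cfunM; first exact: cfun_expR.
by apply: cfunD; [exact: cfun_expR | exact: cfun_cst].
Qed.

Lemma cfun_laplacian (E : rel V) mu w v : cfun (fun u => laplacian E mu w u v).
Proof.
apply: cfunM; first exact: cfun_cst.
apply: cfun_sum => y; apply: cfunM; first exact: cfun_cst.
by apply: cfunD; [exact: cfun_eval | apply: cfunN; exact: cfun_eval].
Qed.

Lemma in_coords_continuous H : (forall v, cfun (fun u => H u v)) -> continuous (in_coords H).
Proof.
move=> h.
have -> : in_coords H = fun x => \sum_i H (of_coords x) (enum_val i) *: delta_mx 0 i.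
  apply/funext => x; rewrite [LHS]row_sum_delta; apply: eq_bigr => i _.
  by rewrite /in_coords /coords mxE.
apply: continuous_big; first exact: add_continuous.
by move=> i _ x; exact: cvgZr_tmp (h (enum_val i) x).
Qed.

Lemma vertex_homotopy H0 H1 (r : R) : 0 < r ->
  (forall v, cfun (fun u => H0 u v)) -> (forall v, cfun (fun u => H1 u v)) ->
  (forall t u, 0 <= t <= 1 -> (forall v, (1 - t) * H0 u v + t * H1 u v = 0) ->
     forall v, `|u v| < r) ->
  exists2 N0, (0 < N0)%N & forall N, (N0 <= N)%N ->
    cube_degree r N (in_coords H0) = cube_degree r N (in_coords H1).
Proof.
move=> r0 c0 c1 Hz; apply: cube_degree_homotopy => //; try exact: in_coords_continuous.
move=> t x t01 xr; apply/eqP => /rowP e0.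
have /(Hz t (of_coords x) t01) small v : (1 - t) * H0 (of_coords x) v + t * H1 (of_coords x) v = 0.
  by have := e0 (enum_rank v); rewrite !mxE enum_rankK.
suff : `|x| < r by rewrite xr ltxx.
by apply: row_norm_lt => // i; have := small (enum_val i); rewrite /of_coords enum_valK.
Qed.

Lemma cube_degree_separable H (phi : V -> R -> R) (r : R) N : (0 < N)%N ->
  (forall u v, H u v = phi v (u v)) ->
  cube_degree r N (in_coords H) =
  \prod_(v : V) ((0 < phi v r)%R%:R - (0 < phi v (- r))%R%:R).
Proof.
move=> N0 HE.
pose c (i : 'I_#|V|) (m : nat) : int :=
  (0 < phi (enum_val i) (- r + 2 * r / N%:R * m%:R))%R%:R.
rewrite /cube_degree /grid_degree.
have -> : grid_signs (const_mx (- r)) (2 * r / N%:R) (in_coords H) = fun k y => c k (y k).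
  apply/funext => k; apply/funext => y.
  by rewrite /grid_signs /signs /in_coords /coords mxE HE /of_coords enum_valK !mxE.
rewrite gdegree_separable [RHS](reindex_onto (enum_val (A := V)) enum_rank) /=; last first.
  by move=> v _; rewrite enum_rankK.
apply: eq_big => [i|i _]; first by rewrite enum_valK eqxx.
rewrite /c mulr0 addr0 divfK ?pnatr_eq0 -?lt0n //.
by rewrite (_ : - r + 2 * r = r) //; ring.
Qed.

End VertexMaps.

(** * Homotopies *)

(** The required fineness depends on the homotopy and on the radius, so chained homotopies are
    compared for large N only. *)
Definition eventually_eq (a b : nat -> int) :=
  exists2 N0, (0 < N0)%N & forall N, (N0 <= N)%N -> a N = b N.

Lemma eventually_eq_trans b a c :
  eventually_eq a b -> eventually_eq b c -> eventually_eq a c.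
Proof.
move=> [N0 N00 H0] [N1 N10 H1]; exists (maxn N0 N1); first by rewrite leq_max N00.
by move=> N; rewrite geq_max => /andP[n0 n1]; rewrite H0 // H1.
Qed.

Section ChernSimonsHiggs.
Variables (R : realType) (V : finType) (E : rel V) (mu : V -> R) (w : V -> V -> R).
Hypothesis E_sym : symmetric E.
Hypothesis E_conn : forall x y : V, connect E x y.
Hypothesis mu_gt0 : forall x, 0 < mu x.
Hypothesis w_gt0 : forall x y, E x y -> 0 < w x y.
Hypothesis w_sym : forall x y, E x y -> w x y = w y x.
Variables (lambda : R) (f : V -> R).

Local Notation lap := (laplacian E mu w).
Local Notation integ := (integralV mu).
Local Notation csh := (CSH_map E mu w lambda f).

Lemma CSH_mapE g u v :
  CSH_map E mu w lambda g u v = - lap u v + (lambda * chern_simons (u v) + g v).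
Proof. by rewrite /CSH_map /chern_simons !mulrA addrA. Qed.

Lemma integral_zero u (h : V -> R) : (forall v, - lap u v + h v = 0) -> integ h = 0.
Proof.
move=> H; rewrite -[RHS](integral_laplacian E_sym mu_gt0 w_sym u).
apply: eq_bigr => v _; congr (_ * _).
by apply/eqP; rewrite -subr_eq0 addrC H.
Qed.

Lemma integralVD g h : integ (fun v => g v + h v) = integ g + integ h.
Proof. by rewrite /integralV -big_split; apply: eq_bigr => v _; rewrite mulrDr. Qed.

Lemma integralVZ a g : integ (fun v => a * g v) = a * integ g.
Proof. by rewrite /integralV mulr_sumr; apply: eq_bigr => v _; rewrite mulrCA. Qed.

Lemma integralV_cst (a : R) : integ (fun=> a) = (\sum_v mu v) * a.
Proof. by rewrite /integralV mulr_suml. Qed.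

(** Matrix of minus the Laplacian for row vectors multiplied from the left: [j] is the input vertex,
    [i] the output vertex. *)
Definition lap_mx : 'M[R]_#|V| := \matrix_(j, i) - ((mu (enum_val i))^-1 *
  \sum_(y | E (enum_val i) y) w (enum_val i) y * ((enum_rank y == j)%:R - (i == j)%:R)).

Lemma lap_mxE (x : 'rV[R]_#|V|) i : (x *m lap_mx) 0 i = - lap (of_coords x) (enum_val i).
Proof.
have sel k : \sum_j x 0 j * (k == j)%:R = x 0 k.
  rewrite (bigD1 k) //= eqxx mulr1 big1 ?addr0 // => j /negbTE jk.
  by rewrite eq_sym jk mulr0.
rewrite mxE /laplacian mulr_sumr -sumrN.
rewrite (eq_bigr (fun j => \sum_(y | E (enum_val i) y) - ((mu (enum_val i))^-1 *
   (w (enum_val i) y * (x 0 j * (enum_rank y == j)%:R - x 0 j * (i == j)%:R))))); last first.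
  move=> j _; rewrite mxE mulrN mulr_sumr mulr_sumr -sumrN; apply: eq_bigr => y _; ring.
rewrite exchange_big /=; apply: eq_bigr => y _.
rewrite sumrN -!mulr_sumr sumrB !sel.
by rewrite /of_coords enum_valK.
Qed.

Lemma csh_expmap : in_coords csh =
  expmap lap_mx (coords f) (const_mx lambda) (const_mx (- lambda)).
Proof.
apply/funext => x; apply/rowP => i.
rewrite /in_coords /expmap [RHS]mxE [X in _ = X + _]mxE lap_mxE !mxE CSH_mapE /chern_simons.
have -> : of_coords x (enum_val i) = x 0 i by rewrite /of_coords enum_valK.
rewrite (_ : expR (2 * x 0 i) = expR (x 0 i) * expR (x 0 i)); first by ring.
by rewrite -expRD; congr expR; ring.
Qed.

Lemma csh_cfun g v : cfun (fun u => CSH_map E mu w lambda g u v).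
Proof.
apply: cfunD; last exact: cfun_cst.
apply: cfunD; first by apply: cfunN; exact: cfun_laplacian.
apply: cfunM; first by apply: cfunM; [exact: cfun_cst | apply: cfun_expR; exact: cfun_eval].
by apply: cfunD; [apply: cfun_expR; exact: cfun_eval | exact: cfun_cst].
Qed.

Lemma zeros_bounded (B kappa : R) : lambda != 0 -> 0 <= B -> 0 < kappa ->
  exists2 R0, 0 < R0 & forall g u, (forall v, `|g v| <= B) -> kappa <= `|integ g| ->
    (forall v, CSH_map E mu w lambda g u v = 0) -> forall v, `|u v| < R0.
Proof.
move=> l0 B0 k0; have [R0 R00 H] := a_priori E_conn mu_gt0 w_gt0 l0 B0 k0.
exists R0 => // g u gB gk eqn; apply: (H 1 g u _ gB gk).
- by rewrite ler01 lexx.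
- by move=> v; rewrite mul1r -CSH_mapE.
- by apply: (@integral_zero u) => v; rewrite -CSH_mapE.
Qed.

Lemma csh_convex g h t u v :
  (1 - t) * CSH_map E mu w lambda g u v + t * CSH_map E mu w lambda h u v =
  CSH_map E mu w lambda (fun v => (1 - t) * g v + t * h v) u v.
Proof. by rewrite !CSH_mapE; ring. Qed.

(** The map is affine in its inhomogeneity, so a segment between two such maps consists of such
    maps; only the integral must be kept away from 0. *)
Lemma csh_homotopy g h (kappa : R) : lambda != 0 -> 0 < kappa ->
  (forall t, 0 <= t <= 1 -> kappa <= `|integ (fun v => (1 - t) * g v + t * h v)|) ->
  exists2 R0, 0 < R0 & forall r, R0 <= r ->
    eventually_eq (cube_degree r ^~ (in_coords (CSH_map E mu w lambda g)))
                  (cube_degree r ^~ (in_coords (CSH_map E mu w lambda h))).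
Proof.
move=> l0 k0 Hk; pose B := \sum_v (`|g v| + `|h v|).
have B0 : 0 <= B by apply: sumr_ge0 => v _; rewrite addr_ge0.
have [R0 R00 HR] := zeros_bounded l0 B0 k0.
exists R0 => // r rR; apply: vertex_homotopy; try by move=> v; exact: csh_cfun.
  exact: lt_le_trans rR.
move=> t u t01 eqn v; apply: lt_le_trans rR.
apply: HR (Hk t t01) _ v => [v|v]; last by rewrite -csh_convex.
apply: le_trans (ler_normD _ _) _; rewrite !normrM.
have /andP[t0 t1] := t01.
rewrite (ger0_norm t0) ger0_norm ?subr_ge0 //.
apply: (@le_trans _ _ (`|g v| + `|h v|)).
  by apply: lerD; rewrite ler_piMl // gerBl.
by rewrite /B (bigD1 v) //= lerDl sumr_ge0 // => y _; rewrite addr_ge0.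
Qed.

Lemma measure_gt0 (x0 : V) : 0 < \sum_v mu v.
Proof.
by rewrite (bigD1 x0) //= ltr_pwDl // sumr_ge0 // => v _; exact: ltW.
Qed.

Lemma degree_decoupled (c r : R) N : 0 < lambda -> c < 0 -> - c / lambda < r ->
  (0 < N)%N ->
  cube_degree r N (in_coords (fun (u : V -> R) v => lambda * chern_simons (u v) + c)) = 1.
Proof.
move=> l0 c0 rc N0.
rewrite (@cube_degree_separable R V _ (fun _ s => lambda * chern_simons s + c)) //.
have r0 : 0 < r by apply: lt_trans rc; rewrite divr_gt0 // oppr_gt0.
apply: big1 => v _.
have -> : 0 < lambda * chern_simons r + c.
  rewrite -ltrBlDr sub0r mulrC -ltr_pdivrMr //.
  by apply: lt_le_trans rc _; exact: chern_simons_gt0.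
rewrite [X in _ - X](_ : _ = 0) ?subr0 //.
have -> // : 0 < lambda * chern_simons (- r) + c = false.
have h : lambda * chern_simons (- r) <= 0.
  by rewrite mulr_ge0_le0 ?(ltW l0) // ltW // chern_simons_lt0 // oppr_lt0.
by apply/negbTE; rewrite -leNgt; move: h c0; lra.
Qed.

Lemma degree_pos (x0 : V) : 0 < lambda -> integ f < 0 ->
  exists2 R0, 0 < R0 & forall r, R0 <= r ->
    eventually_eq (cube_degree r ^~ (in_coords csh)) (fun=> 1).
Proof.
move=> l0 f0; have m0 := measure_gt0 x0.
pose c := integ f / \sum_v mu v.
have c0 : c < 0 by rewrite /c pmulr_llt0 // invr_gt0.
have intc : integ (fun=> c) = integ f by rewrite integralV_cst mulrC divfK // gt_eqF.
have k0 : 0 < `|integ f| by rewrite normr_gt0 lt_eqF.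
have [|R1 R10 H1] := @csh_homotopy f (fun=> c) `|integ f| (lt0r_neq0 l0) k0.
  by move=> t _; rewrite integralVD (integralVZ _ f) (integralVZ _ (fun=> c)) intc -mulrDl subrK mul1r.
have q0 : 0 <= - c / lambda by rewrite divr_ge0 ?oppr_ge0 ?ltW.
exists (R1 + (1 + - c / lambda)); first by rewrite addr_gt0 // ltr_pwDl.
move=> r rR; have rR1 : R1 <= r by move: rR q0; lra.
have rq : 1 + - c / lambda <= r by move: rR R10; lra.
apply: eventually_eq_trans (H1 r rR1) _.
apply: (@eventually_eq_trans (cube_degree r ^~
  (in_coords (fun (u : V -> R) v => lambda * chern_simons (u v) + c)))); last first.
  exists 1%N => // N N0; apply: degree_decoupled => //.
  by apply: lt_le_trans rq; rewrite ltrDr.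
apply: vertex_homotopy.
- by apply: lt_le_trans rR1.
- by move=> v; exact: csh_cfun.
- move=> v; apply: cfunD; last exact: cfun_cst.
  by apply: cfunM; [exact: cfun_cst | apply: cfun_chern_simons; exact: cfun_eval].
move=> t u /andP[t0 t1] eqn.
have eqn' v : - ((1 - t) * lap u v) + (lambda * chern_simons (u v) + c) = 0.
  by rewrite -(eqn v) CSH_mapE; ring.
(* As c < 0, the reaction is positive at a minimum point, so u > 0 everywhere; at a maximum point it
   is at most - c / lambda, which bounds u above. *)
have [vM uM] := exists_max u x0; have [vm um] := exists_min u x0.
have tp : 0 <= 1 - t by rewrite subr_ge0.
have hM : chern_simons (u vM) <= - c / lambda.
  have := eqn' vM; have := mulr_ge0_le0 tp (laplacian_max mu_gt0 w_gt0 uM).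
  by rewrite ler_pdivlMr // => h1 h2; move: h1 h2; lra.
have hm : 0 < chern_simons (u vm).
  have := eqn' vm; have := mulr_ge0 tp (laplacian_min mu_gt0 w_gt0 um).
  by move=> h1 h2; rewrite -(pmulr_rgt0 _ l0); move: h1 h2 c0; lra.
have um0 : 0 < u vm.
  have [//|lt|e] := ltgtP 0 (u vm); last by move: hm; rewrite -e /chern_simons expR0 subrr mulr0 ltxx.
  by have := chern_simons_lt0 lt; move: hm; lra.
move=> v; rewrite ger0_norm; last by apply: ltW; apply: lt_le_trans um0 (um v).
apply: le_lt_trans (uM v) _; apply: lt_le_trans (expR_gt_id _) _.
exact: le_trans (chern_simons_le q0 hM) rq.
Qed.

Lemma degree_zero (x0 : V) : 0 < lambda * integ f ->
  exists2 R0, 0 < R0 & forall r, R0 <= r ->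
    eventually_eq (cube_degree r ^~ (in_coords csh)) (fun=> 0).
Proof.
move=> lf; have m0 := measure_gt0 x0.
have l0 : lambda != 0 by apply: contraTneq lf => ->; rewrite mul0r ltxx.
have f0 : integ f != 0 by apply: contraTneq lf => ->; rewrite mulr0 ltxx.
have l2 : 0 < lambda ^+ 2 by rewrite exprn_even_gt0.
have k0 : 0 < `|integ f| by rewrite normr_gt0.
(* Moving [f] away by a multiple of [lambda] keeps the sign of its integral and
   beats the lower bound -1/4 of the reaction term. *)
pose g v := f v + lambda.
have intg : integ g = integ f + (\sum_v mu v) * lambda.
  by rewrite integralVD integralV_cst.
have [|R1 R10 H1] := @csh_homotopy f g `|integ f| l0 k0.
  move=> t /andP[t0 t1].
  have -> : integ (fun v => (1 - t) * f v + t * g v) = integ f + t * (\sum_v mu v) * lambda.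
    by rewrite integralVD !integralVZ intg; ring.
  rewrite -(@ler_pM2l _ `|lambda|) ?normr_gt0 // -!normrM (gtr0_norm lf).
  apply: le_trans (ler_norm _).
  have -> : lambda * (integ f + t * (\sum_v mu v) * lambda) =
            lambda * integ f + t * (\sum_v mu v) * lambda ^+ 2 by ring.
  rewrite lerDl.
  by apply: mulr_ge0; [apply: mulr_ge0 => //; exact: ltW | exact: ltW].
exists R1 => // r rR; apply: eventually_eq_trans (H1 r rR) _.
apply: cube_degree_nonvanishing.
- exact: lt_le_trans rR.
- by apply: in_coords_continuous => v; exact: csh_cfun.
- by apply/card_gt0P; exists x0.
move=> x _; apply/eqP => /rowP e0.
have eqn v : - lap (of_coords x) v + (lambda * chern_simons (of_coords x v) + g v) = 0.
  by rewrite -CSH_mapE; have := e0 (enum_rank v); rewrite !mxE enum_rankK.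
(* Integrating and multiplying by lambda, the shift contributes lambda^2 times the total measure and
   the reaction at least minus a quarter of it; with lambda int f > 0 the sum cannot vanish. *)
have := integral_zero eqn; rewrite integralVD integralVZ intg => h.
have ge : - (1 / 4) * (\sum_v mu v) <= integ (fun v => chern_simons (of_coords x v)).
  rewrite mulr_sumr /integralV; apply: ler_sum => v _.
  by rewrite mulrC ler_pM2l // chern_simons_ge.
have : lambda ^+ 2 * (- (1 / 4) * (\sum_v mu v)) <=
       lambda ^+ 2 * integ (fun v => chern_simons (of_coords x v)) by rewrite ler_pM2l.
have := mulr_gt0 l2 m0.
have : lambda * (lambda * integ (fun v => chern_simons (of_coords x v)) + (integ f + (\sum_v mu v) * lambda)) = 0.
  by rewrite h mulr0.
by rewrite expr2; move: lf; lra.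
Qed.

Lemma degree_reflection (x0 : V) (r : R) N : 0 < r -> (0 < N)%N ->
  cube_degree r N (in_coords (fun (u : V -> R) v => if v == x0 then - u v else u v)) = -1.
Proof.
move=> r0 N0.
rewrite (@cube_degree_separable R V _ (fun v s => if v == x0 then - s else s)) //; last first.
rewrite (bigD1 x0) //= eqxx opprK r0 oppr_gt0 ltNge (ltW r0) /= big1 ?mulr1 ?sub0r //.
by move=> v /negbTE ->; rewrite r0 oppr_gt0 ltNge (ltW r0) subr0.
Qed.

Lemma degree_neg (x0 : V) : lambda < 0 -> 0 < integ f ->
  exists2 R0, 0 < R0 & forall r, R0 <= r ->
    eventually_eq (cube_degree r ^~ (in_coords csh)) (fun=> -1).
Proof.
move=> l0 f0; have m0 := measure_gt0 x0.
have k0 : 0 < `|integ f| by rewrite normr_gt0 gt_eqF.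
pose B := \sum_v `|f v|.
have B0 : 0 <= B by apply: sumr_ge0.
have fB v : `|f v| <= B by rewrite /B (bigD1 v) //= lerDl sumr_ge0.
have [R1 R10 H1] := a_priori E_conn mu_gt0 w_gt0 (ltr0_neq0 l0) B0 k0.
(* For a constant b > Q the mean [A] is negative, because lambda b plus the mean of f already is. *)
pose Q := integ f / (\sum_v mu v) / - lambda.
have Q0 : 0 < Q by rewrite divr_gt0 ?oppr_gt0 // divr_gt0.
pose N_ (u : V -> R) v := lambda * chern_simons (u v) + f v.
pose A (u : V -> R) := integ (N_ u) / \sum_v mu v.
have cA : cfun A.
  apply: cfunM; last exact: cfun_cst.
  apply: cfun_sum => v; apply: cfunM; first exact: cfun_cst.
  apply: cfunD; last exact: cfun_cst.
  by apply: cfunM; [exact: cfun_cst | apply: cfun_chern_simons; exact: cfun_eval].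
have cL v : cfun (fun u : V -> R => - lap u v) by apply: cfunN; exact: cfun_laplacian.
have ce v : cfun (fun u : V -> R => u v) by exact: cfun_eval.
exists (R1 + 1 + Q); first by rewrite !addr_gt0.
move=> r rR; have r0 : 0 < r by move: rR R10 Q0; lra.
have rR1 : R1 <= r by move: rR R10 Q0; lra.
have rQ : Q < r by move: rR R10; lra.
have cstE b : integralV mu (fun=> b) / (\sum_v mu v) = b.
  by rewrite integralV_cst mulrC mulrA mulVf ?mul1r // gt_eqF.
(* Replace the reaction by its mean [A], then [A] by minus the value at [x0],
   then the Laplacian by minus the identity, and finally decouple. *)
pose H2 (u : V -> R) v := - lap u v + A u.
pose H3 (u : V -> R) v := - lap u v - u x0.
(* The coefficient 2 matters: u v - u x0 would vanish on the constants, whereas this map equals - u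
   x0 at [x0] and has trivial kernel. *)
pose H4 (u : V -> R) v := u v - 2 * u x0.
pose H5 (u : V -> R) v := if v == x0 then - u v else u v.
have c2 v : cfun (fun u => H2 u v) by apply: cfunD.
have c3 v : cfun (fun u => H3 u v) by apply: cfunD => //; exact: cfunN.
have c4 v : cfun (fun u => H4 u v).
  by apply: cfunD => //; apply: cfunN; apply: cfunM => //; exact: cfun_cst.
have c5 v : cfun (fun u => H5 u v).
  by rewrite /H5; case: eqP => // _; exact: cfunN.
apply: (@eventually_eq_trans (cube_degree r ^~ (in_coords H2))).
  apply: vertex_homotopy => //; first by move=> v; exact: csh_cfun.
  move=> t u /andP[t0 t1] eqn v; apply: lt_le_trans rR1.
  have eqn' y : - lap u y + ((1 - t) * N_ u y + t * A u) = 0.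
    by rewrite -(eqn y) CSH_mapE /H2 /N_; ring.
  (* Integration makes the mean vanish at a zero, so the equation is that of [a_priori] with s = 1 -
     t, and the integral condition survives at t = 1. *)
  have intN : integ (N_ u) = 0.
    have := integral_zero eqn'; rewrite integralVD integralVZ integralV_cst.
    rewrite /A mulrCA [_ * (_ / _)]mulrCA mulfV ?gt_eqF // mulr1 -mulrDl subrK.
    by rewrite mul1r.
  apply: (H1 (1 - t) f u) => // [|y].
    by rewrite subr_ge0 t1 gerBl.
  by have := eqn' y; rewrite /A intN mul0r mulr0 addr0.
apply: (@eventually_eq_trans (cube_degree r ^~ (in_coords H3))).
  apply: vertex_homotopy => //.
  move=> t u /andP[t0 t1] eqn v.
  have eqn' y : - lap u y + ((1 - t) * A u - t * u x0) = 0.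
    by rewrite -(eqn y) /H2 /H3; ring.
  (* A zero is thus harmonic, hence a constant b with (1 - t) A = t b. Since A > 0 for b < 0 and A <
     0 for b > Q, this forces 0 <= b <= Q. *)
  have mean0 : (1 - t) * A u - t * u x0 = 0.
    by rewrite -[LHS]cstE (integral_zero eqn') mul0r.
  have uc y : u y = u x0.
    apply: (harmonic_const E_conn mu_gt0 w_gt0) => z.
    by have /eqP := eqn' z; rewrite mean0 addr0 oppr_eq0 => /eqP.
  rewrite uc; have AE : A u = lambda * chern_simons (u x0) + integ f / \sum_v mu v.
    rewrite /A /N_; have -> : u = fun=> u x0 by apply/funext => y; exact: uc.
    rewrite integralVD mulrDl; congr (_ + _).
    exact: cstE.
  move: (u x0) AE mean0 => b AE mean0.
  have fp : 0 < integ f / \sum_v mu v by rewrite divr_gt0.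
  have b0 : 0 <= b.
    rewrite leNgt; apply/negP => bn.
    have An : 0 < A u.
      by rewrite AE addr_gt0 // nmulr_rgt0 // chern_simons_lt0.
    have tb : t * b <= 0 by rewrite mulr_ge0_le0 // ltW.
    have tA : 0 <= (1 - t) * A u by rewrite mulr_ge0 ?subr_ge0 // ltW.
    have tA0 : (1 - t) * A u = 0 by move: mean0 tb tA; lra.
    have tb0 : t * b = 0 by move: mean0 tb tA; lra.
    move: tA0 tb0 => /eqP; rewrite mulf_eq0 (gt_eqF An) orbF => /eqP t1' /eqP.
    by rewrite mulf_eq0 (lt_eqF bn) orbF => /eqP t0'; move: t1' t0'; lra.
  rewrite ger0_norm //; apply: le_lt_trans rQ.
  rewrite leNgt; apply/negP => Qb.
  have bp : 0 < b := lt_trans Q0 Qb.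
  have An : A u < 0.
    have h := chern_simons_gt0 bp.
    have h2 : integ f / (\sum_v mu v) < - lambda * b.
      by rewrite [- lambda * b]mulrC -ltr_pdivrMr // oppr_gt0.
    have h3 : lambda * chern_simons b <= lambda * b by rewrite ler_nM2l.
    by rewrite AE; move: h2 h3; lra.
  have tb : 0 <= t * b by rewrite mulr_ge0 // ltW.
  have tA : (1 - t) * A u <= 0 by rewrite mulr_ge0_le0 ?subr_ge0 // ltW.
  have tA0 : (1 - t) * A u = 0 by move: mean0 tb tA; lra.
  have tb0 : t * b = 0 by move: mean0 tb tA; lra.
  move: tA0 tb0 => /eqP; rewrite mulf_eq0 (lt_eqF An) orbF => /eqP t1' /eqP.
  by rewrite mulf_eq0 (gt_eqF bp) orbF => /eqP t0'; move: t1' t0'; lra.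
apply: (@eventually_eq_trans (cube_degree r ^~ (in_coords H4))).
  apply: vertex_homotopy => //.
  move=> t u /andP[t0 t1] eqn v.
  have eqn' y : - ((1 - t) * lap u y) + t * u y = (1 + t) * u x0.
    by apply/eqP; rewrite -subr_eq0; apply/eqP; rewrite -(eqn y) /H3 /H4; ring.
  have tp : 0 <= 1 - t by rewrite subr_ge0.
  have [vM uM] := exists_max u x0; have [vm um] := exists_min u x0.
  (* The maximum principle squeezes t u between equal bounds, so t u is constantly (1 + t) u x0; at
     x0 this gives u x0 = 0. Only t = 0 is left to harmonicity. *)
  have hM : t * u vM <= (1 + t) * u x0.
    have := eqn' vM; have := mulr_ge0_le0 tp (laplacian_max mu_gt0 w_gt0 uM).
    by move=> h1 h2; move: h1 h2; lra.
  have hm : (1 + t) * u x0 <= t * u vm.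
    have := eqn' vm; have := mulr_ge0 tp (laplacian_min mu_gt0 w_gt0 um).
    by move=> h1 h2; move: h1 h2; lra.
  have tu y : t * u y = (1 + t) * u x0.
    have := ler_wpM2l t0 (uM y); have := ler_wpM2l t0 (um y).
    by move=> h1 h2; move: h1 h2 hM hm; lra.
  have u0 : u x0 = 0 by have := tu x0; lra.
  have [t00|tn0] := eqVneq t 0; last first.
    have := tu v; rewrite u0 mulr0 => /eqP; rewrite mulf_eq0 (negbTE tn0) => /eqP ->.
    by rewrite normr0.
  rewrite (harmonic_const E_conn mu_gt0 w_gt0 _ v x0) ?u0 ?normr0 // => y.
  by have := eqn' y; rewrite u0 t00; lra.
apply: (@eventually_eq_trans (cube_degree r ^~ (in_coords H5))).
  apply: vertex_homotopy => //.
  move=> t u /andP[t0 t1] eqn v.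
  have u0 : u x0 = 0 by have := eqn x0; rewrite /H4 /H5 eqxx; lra.
  have [->|vx] := eqVneq v x0; first by rewrite u0 normr0.
  have := eqn v; rewrite /H4 /H5 (negbTE vx) u0 => h.
  by rewrite (_ : u v = 0) ?normr0 //; move: h; lra.
by exists 1%N => // N N0; exact: degree_reflection.
Qed.

End ChernSimonsHiggs.

(** * The degree on balls of functions *)

Lemma coords_linf_ball (R : realType) (V : finType) (r : R) : 0 < r ->
  @coords R V @` @linf_ball R V r = [set x | `|x| < r].
Proof.
move=> r0; apply/seteqP; split=> [_ [u ur <-]|x /= xr].
  apply: row_norm_lt => // i; rewrite mxE; apply: le_lt_trans ur.
  exact: le_bigmax.
exists (of_coords x); last by apply/rowP => i; rewrite mxE /of_coords enum_valK.
apply/bigmax_ltP; split=> // v _.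
exact: le_lt_trans (coord_le_norm x (enum_rank v)) xr.
Qed.

Theorem theorem2 (R : realType) (V : finType) (E : rel V)
    (E_irr : irreflexive E) (E_sym : symmetric E)
    (E_conn : forall x y : V, connect E x y)
    (mu : V -> R) (mu_gt0 : forall x, 0 < mu x)
    (w : V -> V -> R) (w_gt0 : forall x y, E x y -> 0 < w x y)
    (w_sym : forall x y, E x y -> w x y = w y x)
    (lambda : R) (f : V -> R) :
  lambda * integralV mu f != 0 ->
  exists2 R0 : R, 0 < R0 &
    forall r : R, R0 <= r ->
      let F := CSH_map E mu w lambda f in
      let B := @linf_ball R V r in
      let z : V -> R := fun=> 0 in
      fun_degree_admissible F B z /\
      [/\ 0 < lambda -> integralV mu f < 0 -> fun_degree F B z = 1,
          0 < lambda * integralV mu f -> fun_degree F B z = 0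
        & lambda < 0 -> 0 < integralV mu f -> fun_degree F B z = -1].
Proof.
move=> lf0; have l0 : lambda != 0 by apply: contraNneq lf0 => ->; rewrite mul0r.
have f0 : integralV mu f != 0 by apply: contraNneq lf0 => ->; rewrite mulr0.
have [x0 _] : exists x0 : V, true.
  apply: contrapT => noV; case/eqP: f0; apply: big1 => x _.
  by case: noV; exists x.
have n0 : (0 < #|V|)%N by apply/card_gt0P; exists x0.
pose F := CSH_map E mu w lambda f.
have cF : continuous (in_coords F).
  by apply: in_coords_continuous => v; exact: csh_cfun.
have coords0 : coords (fun=> 0 : R) = 0 :> 'rV[R]_#|V| by apply/rowP => i; rewrite !mxE.
have [||Rz Rz0 Hz] := zeros_bounded E_sym E_conn mu_gt0 w_gt0 w_sym
  (B := \sum_v `|f v|) (kappa := `|integralV mu f|) l0.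
- exact: sumr_ge0.
- by rewrite normr_gt0.
have bdF r x : Rz <= r -> `|x| = r -> in_coords F x != 0.
  move=> rR xr; apply/eqP => /rowP e0.
  suff : `|x| < r by rewrite xr ltxx.
  apply: row_norm_lt => [|i]; first exact: lt_le_trans rR.
  have -> : x 0 i = of_coords x (enum_val i) by rewrite /of_coords enum_valK.
  apply: lt_le_trans rR; apply: (Hz f) => // [v|v].
    by rewrite (bigD1 v) //= lerDl sumr_ge0.
  by have := e0 (enum_rank v); rewrite !mxE enum_rankK.
have adm r : Rz <= r -> fun_degree_admissible F (@linf_ball R V r) (fun=> 0).
  move=> rR; have r0 : 0 < r := lt_le_trans Rz0 rR.
  rewrite /fun_degree_admissible coords_linf_ball // coords0; split.
  - have -> : [set x : 'rV[R]_#|V| | `|x| < r] = Num.norm @^-1` [set t | t < r]%classic by [].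
    by apply: open_comp (@open_lt _ r) => x _; exact: norm_continuous.
  - exists r; split; first exact: num_real.
    by move=> M rM x /= xr; apply/ltW/(lt_trans xr).
  - exact: continuous_subspaceT.
  - by move=> x /bdry_sub_sphere xr; apply/eqP/(bdF r).
have key d R1 : 0 < R1 -> (forall r, R1 <= r ->
    eventually_eq (cube_degree r ^~ (in_coords F)) (fun=> d)) ->
  exists2 R0, 0 < R0 & forall r, R0 <= r ->
    fun_degree_admissible F (@linf_ball R V r) (fun=> 0) /\
    fun_degree F (@linf_ball R V r) (fun=> 0) = d.
  move=> R10 H1; exists (R1 + Rz); first by rewrite addr_gt0.
  move=> r rR; have r1 : R1 <= r by apply: le_trans rR; rewrite lerDl ltW.
  have rz : Rz <= r by apply: le_trans rR; rewrite lerDr ltW.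
  have r0 : 0 < r := lt_le_trans Rz0 rz.
  split; first exact: adm.
  rewrite /fun_degree coords_linf_ball // coords0.
  have [N0 _ HN] := H1 r r1.
  apply: (brouwer_degree_cube (N0 := N0)) => //; right.
  rewrite /F csh_expmap; apply: expmap_regular_approx => // x xr.
  by rewrite -csh_expmap; apply: bdF xr.
have [lp|ln|/eqP] := ltgtP 0 lambda; last by rewrite eq_sym (negbTE l0).
- have [fp|fn|/eqP] := ltgtP 0 (integralV mu f); last by rewrite eq_sym (negbTE f0).
  + have [R1 R10 H1] := degree_zero E_sym E_conn mu_gt0 w_gt0 w_sym x0 (mulr_gt0 lp fp).
    have [R0 R00 H] := key 0 R1 R10 H1; exists R0 => // r /H[ad de] /=.
    by split=> //; split.
  + have [R1 R10 H1] := degree_pos E_sym E_conn mu_gt0 w_gt0 w_sym x0 lp fn.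
    have [R0 R00 H] := key 1 R1 R10 H1; exists R0 => // r /H[ad de] /=.
    by split=> //; split=> //; rewrite pmulr_rgt0 // => /(lt_trans fn); rewrite ltxx.
- have [fp|fn|/eqP] := ltgtP 0 (integralV mu f); last by rewrite eq_sym (negbTE f0).
  + have [R1 R10 H1] := degree_neg E_sym E_conn mu_gt0 w_gt0 w_sym x0 ln fp.
    have [R0 R00 H] := key (-1) R1 R10 H1; exists R0 => // r /H[ad de] /=.
    by split=> //; split=> //; rewrite nmulr_rgt0 // => /(lt_trans fp); rewrite ltxx.
  + have lf : 0 < lambda * integralV mu f by rewrite nmulr_rgt0.
    have [R1 R10 H1] := degree_zero E_sym E_conn mu_gt0 w_gt0 w_sym x0 lf.
    have [R0 R00 H] := key 0 R1 R10 H1; exists R0 => // r /H[ad de] /=.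
    by split=> //; split.
Qed.
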